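(* Consider the nonlinear program: minimize $f(x)$ subject to $\varphi_i(x)\le0$ ($i=1,\dots,s$), $\varphi_i(x)=0$ ($i=s+1,\dots,m$), with $f$ and all $\varphi_i$ $\mathcal C^2$-smooth around a feasible $\bar x$ such that $\nabla_xL(\bar x,\bar y)=0$ and $\langle\bar y,g(\bar x)\rangle=0$ for some $\bar y\in\mathbb{R}_+^s\times\mathbb{R}^{m-s}$, and suppose MSCQ holds at $\bar x$. Let $\Phi:=f+\delta_\Gamma$. (i) If there exist neighborhoods $U$ of $\bar x$ and $V$ of $0$ such that $\langle\nabla^2f(x)w,w\rangle+\langle w,\nabla^2\langle y,g\rangle(x)w\rangle\ge0$ for all $x\in U$, $v\in V$, all $y\in\mathbb{R}_+^s\times\mathbb{R}^{m-s}$ with $v=\nabla_xL(x,y)$ and $\langle y,g(x)\rangle=0$, and all $w\in S(x,y)$, then $\Phi$ is variationally convex at $\bar x$ for $0$, and $\bar x$ is a local minimizer. (ii) If there exist $\sigma>0$ and such neighborhoods with $\langle\nabla^2f(x)w,w\rangle+\langle w,\nabla^2\langle y,g\rangle(x)w\rangle\ge\sigma\|w\|^2$ for all such $x,v,y,w$, then $\Phi$ is strongly variationally convex at $\bar x$ for $0$ with modulus $\sigma$, and $\bar x$ is a tilt-stable local minimizer of $\Phi$ with modulus $\sigma^{-1}$ (in particular a strong local minimizer).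
   Context: $g:=(\varphi_1,\dots,\varphi_m)$, $\Gamma$ the feasible set, $\delta_\Gamma$ its indicator; $L(x,y):=f(x)+\langle y,g(x)\rangle$; $I(x):=\{i\le s:\varphi_i(x)=0\}$, $I_+(x,y):=\{i\in I(x):y_i>0\}$, $S(x,y):=\{w:\langle\nabla\varphi_i(x),w\rangle=0\ (i\in\{s+1,\dots,m\}\cup I_+(x,y)),\ \langle\nabla\varphi_i(x),w\rangle\ge0\ (i\in I(x)\setminus I_+(x,y))\}$. MSCQ at $\bar x$: $\operatorname{dist}(x;\Gamma)\le\kappa\big(\sum_{i\le s}\max\{\varphi_i(x),0\}+\sum_{i>s}|\varphi_i(x)|\big)$ for some $\kappa>0$ and all $x$ near $\bar x$. Variational convexity of l.s.c. $\Phi$ at $\bar x$ for $\bar v\in\partial\Phi(\bar x)$ (limiting subdifferential): there exist a convex neighborhood $U\times V$ of $(\bar x,\bar v)$, $\varepsilon>0$, and l.s.c. convex $\psi\le\Phi$ on $U$ with $(U_\varepsilon\times V)\cap\operatorname{gph}\partial\Phi=(U\times V)\cap\operatorname{gph}\partial\psi$ and $\Phi=\psi$ at common elements, $U_\varepsilon:=\{x\in U:\Phi(x)<\Phi(\bar x)+\varepsilon\}$; strong version: $\psi$ strongly convex on $U$ with modulus $\sigma$. Tilt-stable local minimizer: for some $\gamma>0$, $M_\gamma(v):=\operatorname{argmin}\{\Phi(x)-\langle v,x\rangle:\|x-\bar x\|\le\gamma\}$ is single-valued and Lipschitz near $0$ with $M_\gamma(0)=\{\bar x\}$; modulus = a Lipschitz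 constant of $M_\gamma$. *)

(* Defs.v *)
From HB Require Import structures.
From mathcomp Require Import all_boot all_order all_algebra.
From mathcomp Require Import all_classical all_reals all_analysis.
Set Implicit Arguments. Unset Strict Implicit. Unset Printing Implicit Defensive.
Import Order.TTheory GRing.Theory Num.Theory.
Import numFieldNormedType.Exports.
Local Open Scope classical_set_scope.
Local Open Scope ring_scope.

Section Defs.
Variable R : realType.
Variable n : nat.
Local Notation vec := 'rV[R]_n.

Definition dot (u v : vec) : R := \sum_(i < n) u 0 i * v 0 i.
Definition enorm (u : vec) : R := Num.sqrt (dot u u).

Definition unitv (i : 'I_n) : vec := delta_mx 0 i.

Definition grad (f : vec -> R) (x : vec) : vec :=
  \row_i derive f x (unitv i).
Definition hess (f : vec -> R) (x : vec) : 'M[R]_n :=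
  \matrix_(i, j) derive (fun z => derive f z (unitv i)) x (unitv j).
Definition quad (A : 'M[R]_n) (w : vec) : R := dot (w *m A^T) w.

Definition C2_around (f : vec -> R) (xb : vec) : Prop :=
  exists r : R, 0 < r /\ forall x : vec, enorm (x - xb) < r ->
    forall i j : 'I_n,
      derivable f x (unitv i) /\
      derivable (fun z => derive f z (unitv i)) x (unitv j) /\
      {for x, continuous (fun z => derive f z (unitv i))} /\
      {for x, continuous (fun z =>
          derive (fun z' => derive f z' (unitv i)) z (unitv j))}.

Definition dist (x : vec) (A : set vec) : R := inf [set enorm (x - z) | z in A].

Definition rsubdiff (Phi : vec -> \bar R) (x v : vec) : Prop :=
  Phi x \is a fin_num /\
  forall eps : R, 0 < eps -> exists delta : R, 0 < delta /\
    forall u : vec, enorm (u - x) < delta ->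
      (Phi x + (dot v (u - x) - eps * enorm (u - x))%:E <= Phi u)%E.

Definition lsubdiff (Phi : vec -> \bar R) (x v : vec) : Prop :=
  Phi x \is a fin_num /\
  exists (xk vk : nat -> vec),
    xk @ \oo --> x /\ (fun k => Phi (xk k)) @ \oo --> Phi x /\
    vk @ \oo --> v /\ forall k, rsubdiff Phi (xk k) (vk k).

Definition nbhd_of (U : set vec) (x : vec) : Prop :=
  exists r : R, 0 < r /\ forall z, enorm (z - x) < r -> U z.

Definition convex_set (U : set vec) : Prop :=
  forall x y (t : R), U x -> U y -> 0 <= t <= 1 -> U (t *: x + (1 - t) *: y).

Definition sconvex_on (sig : R) (psi : vec -> \bar R) (U : set vec) : Prop :=
  (forall x, U x -> psi x != -oo%E) /\
  forall x y (t : R), U x -> U y -> 0 <= t <= 1 ->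
    (psi (t *: x + (1 - t) *: y)%R <=
       t%:E * psi x + (1 - t)%:E * psi y
       - (sig / 2 * t * (1 - t) * (enorm (x - y)) ^+ 2)%:E)%E.

Definition lsc_on (psi : vec -> \bar R) (U : set vec) : Prop :=
  forall x, U x -> forall a : R, (a%:E < psi x)%E ->
    exists delta : R, 0 < delta /\
      forall u, enorm (u - x) < delta -> (a%:E < psi u)%E.

Definition var_convex_mod (sig : R) (Phi : vec -> \bar R) (xb vb : vec) : Prop :=
  lsubdiff Phi xb vb /\
  exists (U V : set vec) (eps : R) (psi : vec -> \bar R),
    nbhd_of U xb /\ nbhd_of V vb /\ convex_set U /\ convex_set V /\
    0 < eps /\ lsc_on psi U /\ sconvex_on sig psi U /\
    (forall x, U x -> (psi x <= Phi x)%E) /\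
    forall x v,
      ((U x /\ (Phi x < Phi xb + eps%:E)%E) /\ V v /\ lsubdiff Phi x v <->
       U x /\ V v /\ lsubdiff psi x v) /\
      (U x /\ (Phi x < Phi xb + eps%:E)%E /\ V v /\ lsubdiff Phi x v ->
       Phi x = psi x).

Definition var_convex := var_convex_mod 0.

Definition local_min (Phi : vec -> \bar R) (xb : vec) : Prop :=
  exists delta : R, 0 < delta /\
    forall x, enorm (x - xb) < delta -> (Phi xb <= Phi x)%E.

Definition strong_local_min (Phi : vec -> \bar R) (xb : vec) : Prop :=
  exists kappa delta : R, 0 < kappa /\ 0 < delta /\
    forall x, enorm (x - xb) < delta ->
      (Phi xb + (kappa * (enorm (x - xb)) ^+ 2)%:E <= Phi x)%E.

Definition tilt_argmin (Phi : vec -> \bar R) (xb : vec) (gam : R) (v x : vec)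
  : Prop :=
  enorm (x - xb) <= gam /\
  forall z, enorm (z - xb) <= gam ->
    (Phi x - (dot v x)%:E <= Phi z - (dot v z)%:E)%E.

Definition tilt_stable (kappa : R) (Phi : vec -> \bar R) (xb : vec) : Prop :=
  Phi xb \is a fin_num /\
  exists gam : R, 0 < gam /\
  exists (delta : R) (M : vec -> vec), 0 < delta /\ M 0 = xb /\
    (forall v, enorm v < delta ->
       forall x, tilt_argmin Phi xb gam v x <-> x = M v) /\
    (forall v1 v2, enorm v1 < delta -> enorm v2 < delta ->
       enorm (M v1 - M v2) <= kappa * enorm (v1 - v2)).

End Defs.

Section NLP.
Variable R : realType.
Variables n m s : nat.
Local Notation vec := 'rV[R]_n.

Definition feasible (phi : 'I_m -> vec -> R) : set vec :=
  [set x | forall i : 'I_m,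
     ((i < s)%N -> phi i x <= 0) /\ ((s <= i)%N -> phi i x = 0)].

Definition PhiNLP (f : vec -> R) (phi : 'I_m -> vec -> R) (x : vec) : \bar R :=
  if `[< feasible phi x >] then (f x)%:E else +oo%E.

Definition multiplier (y : 'rV[R]_m) : Prop := forall i : 'I_m, (i < s)%N -> 0 <= y 0 i.

Definition ygx (phi : 'I_m -> vec -> R) (y : 'rV[R]_m) (x : vec) : R :=
  \sum_(i < m) y 0 i * phi i x.

Definition gradL (f : vec -> R) (phi : 'I_m -> vec -> R) (x : vec) (y : 'rV[R]_m)
  : vec := grad f x + \sum_(i < m) y 0 i *: grad (phi i) x.

Definition active (phi : 'I_m -> vec -> R) (x : vec) (i : 'I_m) : Prop :=
  (i < s)%N /\ phi i x = 0.

Definition Scone (phi : 'I_m -> vec -> R) (x : vec) (y : 'rV[R]_m) (w : vec)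
  : Prop :=
  forall i : 'I_m,
    ((s <= i)%N \/ (active phi x i /\ 0 < y 0 i) -> dot (grad (phi i) x) w = 0) /\
    (active phi x i /\ ~ (0 < y 0 i) -> 0 <= dot (grad (phi i) x) w).

Definition MSCQ (phi : 'I_m -> vec -> R) (xb : vec) : Prop :=
  exists kappa r : R, 0 < kappa /\ 0 < r /\
    forall x, enorm (x - xb) < r ->
      dist x (feasible phi) <=
        kappa * (\sum_(i < m | (i < s)%N) Num.max (phi i x) 0
                 + \sum_(i < m | (s <= i)%N) `|phi i x|).

Definition sec_order (f : vec -> R) (phi : 'I_m -> vec -> R)
  (x : vec) (y : 'rV[R]_m) (w : vec) : R :=
  quad (hess f x) w + dot w (w *m (hess (ygx phi y) x)^T).

Definition sec_order_cond (sig : R) (f : vec -> R) (phi : 'I_m -> vec -> R)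
  (xb : vec) : Prop :=
  exists rU rV : R, 0 < rU /\ 0 < rV /\
    forall (x v : vec) (y : 'rV[R]_m),
      enorm (x - xb) < rU -> enorm v < rV ->
      multiplier y -> v = gradL f phi x y -> ygx phi y x = 0 ->
      forall w, Scone phi x y w ->
        sig * enorm w ^+ 2 <= sec_order f phi x y w.

End NLP.

(* Main.v *)
(** The graph of the limiting subdifferential of [Phi] near [(xb, 0)] consists of
    the pairs [(x, grad_x L(x, y))] with [x] feasible and [y] a complementary
    multiplier; MSCQ lets one choose [y] bounded, and the Lagrangian then makes
    [Phi] prox-regular. Let [(x_k, v_k) -> (x, v)] in this graph, with multipliers
    [y_k -> y] and directions [(x - x_k) / |x - x_k| -> w]. Complementarity gives
    [<y_k - y, g(x_k) - g(x)> >= 0], and [w] lies in [S(x, y)], so the second-order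
    condition bounds [<v_k - v, x_k - x> / |x_k - x|^2] from below by [sig] in the
    limit. Hence around each of its points, and relative to that point, the
    subdifferential is strongly monotone with every modulus below [sig].

    This pointwise estimate integrates along the Lipschitz path traced by the
    proximal mapping over a segment: the Moreau envelope is convex with modulus
    [sig / (1 + lam * sig)], and undoing the envelope gives the uniform growth
    [Phi(x) >= Phi(x') + <v', x - x'> + sig/2 |x - x'|^2] for [(x', v')] in the
    graph. The supremum of these quadratic minorants is the required convex [psi];
    proximal points show that its subgradients near [(xb, 0)] are subgradients of
    [Phi], and the growth inequality alone gives tilt stability. *)
Require Import Defs.
From HB Require Import structures.
From mathcomp Require Import all_boot all_order all_algebra.
From mathcomp Require Import all_classical all_reals all_analysis.
From mathcomp Require Import ring lra.
Set Implicit Arguments.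
Unset Strict Implicit.
Unset Printing Implicit Defensive.
Import Order.TTheory GRing.Theory Num.Theory.
Import numFieldNormedType.Exports.
Local Open Scope classical_set_scope.
Local Open Scope ring_scope.

(** * Euclidean norm, compactness and subgradients *)

(** Pushes an ultrafilter through a map, so that compactness can be applied to the image. *)
Lemma fmap_ultra {T U : Type} {F : set_system T} (u : T -> U) :
  UltraFilter F -> UltraFilter (u @ F).
Proof.
move=> FU; split=> [|G GF FG]; first by have := @ultra_proper _ _ FU; apply: fmap_proper_filter.
rewrite eqEsubset; split=> // A GA.
have [//|FnA] := in_ultra_setVsetC (u @^-1` A) FU.
have : G (A `&` ~` A) by apply: filterI => //; apply: FG.
by rewrite setICr => /filter_not_empty.
Qed.

Section Euclid.
Context {R : realType} {n : nat}.
Implicit Types (u v w x y z : 'rV[R]_n) (a b t e : R).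

Lemma dotC u v : dot u v = dot v u.
Proof. by apply: eq_bigr => i _; rewrite mulrC. Qed.

Lemma dotDl u v w : dot (u + v) w = dot u w + dot v w.
Proof. by rewrite -big_split; apply: eq_bigr => i _; rewrite mxE mulrDl. Qed.

Lemma dotZl a u v : dot (a *: u) v = a * dot u v.
Proof.
by rewrite /dot big_distrr/=; apply: eq_bigr => i _; rewrite mxE mulrA.
Qed.

Lemma dotDr u v w : dot w (u + v) = dot w u + dot w v.
Proof. by rewrite dotC dotDl !(dotC w). Qed.

Lemma dotZr a u v : dot u (a *: v) = a * dot u v.
Proof. by rewrite dotC dotZl dotC. Qed.

Lemma dotNl u v : dot (- u) v = - dot u v.
Proof. by rewrite -scaleN1r dotZl mulN1r. Qed.

Lemma dotNr u v : dot u (- v) = - dot u v.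
Proof. by rewrite dotC dotNl dotC. Qed.

Lemma dot0l u : dot 0 u = 0.
Proof. by rewrite -(scale0r 0) dotZl mul0r. Qed.

Lemma dot0r u : dot u 0 = 0.
Proof. by rewrite dotC dot0l. Qed.

Lemma dot_suml (I : Type) (r : seq I) (P : pred I) (F : I -> 'rV[R]_n) u :
  dot (\sum_(i <- r | P i) F i) u = \sum_(i <- r | P i) dot (F i) u.
Proof.
elim/big_ind2 : _ => [|a b c d <- <-|//]; [exact: dot0l|exact: dotDl].
Qed.

Lemma dot_ge0 u : 0 <= dot u u.
Proof. by apply: sumr_ge0 => i _; rewrite -expr2 sqr_ge0. Qed.

Lemma dot_coord_le u (i : 'I_n) : u 0 i ^+ 2 <= dot u u.
Proof.
rewrite /dot (bigD1 i)//= -expr2 lerDl.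
by apply: sumr_ge0 => j _; rewrite -expr2 sqr_ge0.
Qed.

Lemma enorm_ge0 u : 0 <= enorm u.
Proof. exact: sqrtr_ge0. Qed.
Hint Resolve enorm_ge0 : core.

Lemma enorm_sqr u : enorm u ^+ 2 = dot u u.
Proof. by rewrite sqr_sqrtr// dot_ge0. Qed.

Lemma enorm0 : enorm (0 : 'rV[R]_n) = 0.
Proof. by rewrite /enorm dot0l sqrtr0. Qed.

Lemma enorm_eq0 u : enorm u = 0 -> u = 0.
Proof.
move=> u0; apply/rowP => i; rewrite mxE; apply/eqP.
have := dot_coord_le u i; rewrite -enorm_sqr u0 expr0n/= => h.
by rewrite -sqrf_eq0 eq_le h sqr_ge0.
Qed.

Lemma enorm_gt0 u : u <> 0 -> 0 < enorm u.
Proof. by move=> u0; rewrite lt_def enorm_ge0 andbT; apply/eqP => /enorm_eq0. Qed.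

Lemma enormZ a u : enorm (a *: u) = `|a| * enorm u.
Proof.
by rewrite /enorm dotZl dotZr mulrA -expr2 sqrtrM ?sqr_ge0// sqrtr_sqr.
Qed.

Lemma enormN u : enorm (- u) = enorm u.
Proof. by rewrite -scaleN1r enormZ normrN1 mul1r. Qed.

Lemma enormC u v : enorm (u - v) = enorm (v - u).
Proof. by rewrite -enormN opprB. Qed.

Lemma cauchy_schwarz u v : dot u v <= enorm u * enorm v.
Proof.
have [v0|v0] := eqVneq (enorm v) 0.
  by rewrite v0 (enorm_eq0 v0) dot0r mulr0.
have [u0|u0] := eqVneq (enorm u) 0.
  by rewrite u0 (enorm_eq0 u0) dot0l mul0r.
have hv : 0 < enorm v by rewrite lt_def v0 enorm_ge0.
have hu : 0 < enorm u by rewrite lt_def u0 enorm_ge0.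
have := dot_ge0 (enorm v *: u - enorm u *: v).
rewrite !(dotDl, dotDr, dotNl, dotNr, dotZl, dotZr) -!enorm_sqr (dotC v u).
move=> h; rewrite -(ler_pM2l (mulr_gt0 hu hv)); nra.
Qed.

Lemma dot_abs_le u v : `|dot u v| <= enorm u * enorm v.
Proof.
rewrite ler_norml cauchy_schwarz andbT lerNl -dotNl.
by rewrite (le_trans (cauchy_schwarz _ _))// enormN.
Qed.

Lemma enormD u v : enorm (u + v) <= enorm u + enorm v.
Proof.
rewrite -(@ler_pXn2r _ 2)// ?nnegrE ?addr_ge0// enorm_sqr.
rewrite dotDl !dotDr -!enorm_sqr (dotC v u).
have := cauchy_schwarz u v; nra.
Qed.

Lemma enormB_sqr u v :
  enorm (u - v) ^+ 2 = enorm u ^+ 2 - 2 * dot u v + enorm v ^+ 2.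
Proof. by rewrite !enorm_sqr dotDl !dotDr !dotNl !dotNr (dotC v u); ring. Qed.

Lemma enorm_trans x y z : enorm (x - z) <= enorm (x - y) + enorm (y - z).
Proof. by rewrite -[x - z](subrKA y) enormD. Qed.

Lemma enormB u v : enorm (u - v) <= enorm u + enorm v.
Proof. by rewrite -(enormN v) enormD. Qed.

Lemma enorm_coord u (i : 'I_n) : `|u 0 i| <= enorm u.
Proof.
by rewrite -(@ler_pXn2r _ 2)// ?nnegrE// enorm_sqr real_normK ?num_real ?dot_coord_le.
Qed.

Lemma enorm_le_coords u t : 0 <= t -> (forall i : 'I_n, `|u 0 i| <= t) ->
  enorm u <= n%:R * t.
Proof.
move=> t0 ut; rewrite -(@ler_pXn2r _ 2)// ?nnegrE ?mulr_ge0// enorm_sqr.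
apply: (@le_trans _ _ (\sum_(i < n) t ^+ 2)).
  apply: ler_sum => i _; rewrite -expr2 -(real_normK (num_real _)).
  by rewrite ler_pXn2r// ?nnegrE.
rewrite sumr_const card_ord exprMn -(mulr_natl (t ^+ 2)).
by rewrite ler_wpM2r ?sqr_ge0// -natrX ler_nat; case: (n) => // k; rewrite leq_pmulr.
Qed.

Lemma normr_le_enorm u : `|u| <= enorm u.
Proof.
rewrite [leLHS]/Num.Def.normr/= mx_normrE; apply/bigmax_leP; split => //= -[i j] _ /=.
by rewrite (ord1 i) enorm_coord.
Qed.

Lemma enorm_le_normr u : enorm u <= n%:R * `|u|.
Proof.
apply: enorm_le_coords => // i.
rewrite [leRHS]/Num.Def.normr/= mx_normrE; apply/bigmax_geP; right => /=.
by exists (0, i).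
Qed.

(** The topology of ['rV[R]_n] comes from the sup norm, while the radii in the definitions are
    Euclidean; the norms are equivalent, so both give the same neighbourhoods. *)
Lemma nbhs_enormP x (P : set 'rV[R]_n) :
  nbhs x P <-> exists2 e, 0 < e & forall y, enorm (y - x) < e -> P y.
Proof.
split=> [/nbhs_ballP[e /= e0 xP]|[e e0 xP]].
  exists e => // y yx; apply: xP; rewrite mx_norm_ball/= distrC.
  exact: le_lt_trans (normr_le_enorm _) yx.
(* [n.+1] instead of [n] keeps the divisor positive when [n] is zero. *)
apply/nbhs_ballP; exists (e / n.+1%:R) => /=; first by rewrite divr_gt0.
move=> y; rewrite mx_norm_ball /= distrC => yx; apply: xP.
apply: (le_lt_trans (enorm_le_normr _)).
move: yx; rewrite ltr_pdivlMr// mulrC; apply: le_lt_trans.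
by rewrite ler_wpM2r// ler_nat.
Qed.

Lemma forall_eball (I : finType) x (P : I -> 'rV[R]_n -> Prop) :
  (forall i, exists2 d, 0 < d & forall y, enorm (y - x) < d -> P i y) ->
  exists2 d, 0 < d & forall y, enorm (y - x) < d -> forall i, P i y.
Proof.
move=> hP; apply/nbhs_enormP.
apply: (@filter_forall _ _ P (nbhs x) _) => i.
by apply/nbhs_enormP; exact: hP.
Qed.

Lemma cvg_enormP {T : Type} {F : set_system T} {FF : Filter F}
    (u : T -> 'rV[R]_n) x :
  (u @ F --> x) <-> forall e, 0 < e -> \forall k \near F, enorm (u k - x) < e.
Proof.
split=> [ux e e0|h P /nbhs_enormP[e e0 xP]].
  by apply: (ux [set y | enorm (y - x) < e]); apply/nbhs_enormP; exists e.
by apply: filterS (h e e0) => k; exact: xP.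
Qed.

Lemma cvg_enorm_dist {T : Type} {F : set_system T} {FF : Filter F}
    (u : T -> 'rV[R]_n) x :
  u @ F --> x -> (fun k => enorm (u k - x)) @ F --> (0 : R).
Proof.
move=> /cvg_enormP ux; apply/cvgrPdist_lt => e e0; near=> k.
by rewrite sub0r normrN ger0_norm//; near: k; exact: ux.
Unshelve. all: by end_near. Qed.

Lemma continuous_enormP (h : 'rV[R]_n -> R) x :
  {for x, continuous h} <-> forall e, 0 < e -> exists2 d, 0 < d &
    forall y, enorm (y - x) < d -> `|h y - h x| < e.
Proof.
split=> [/cvgrPdist_lt hx e e0|hx].
  have /nbhs_enormP[d d0 xd] := hx _ e0.
  by exists d => // y yx; rewrite distrC xd.
apply/(@cvgrPdist_lt _ _ _ (nbhs x)) => e e0; have [d d0 xd] := hx _ e0.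
by apply/nbhs_enormP; exists d => // y yx; rewrite distrC xd.
Qed.

Lemma continuous_coord (i : 'I_n) : continuous (fun x => x 0 i : R).
Proof.
move=> x; apply/continuous_enormP => e e0; exists e => // y; apply: le_lt_trans.
by have := enorm_coord (y - x) i; rewrite !mxE.
Qed.

Lemma enorm_lipschitz x y z : `|enorm (x - z) - enorm (y - z)| <= enorm (x - y).
Proof.
have := enorm_trans x y z; have := enorm_trans y x z.
by rewrite (enormC y x) ler_norml; lra.
Qed.

Lemma continuous_enormB z : continuous (fun x => enorm (x - z)).
Proof.
move=> x; apply/continuous_enormP => e e0; exists e => // y.
exact: le_lt_trans (enorm_lipschitz _ _ _).
Qed.

Lemma continuous_sqr_enormB a z :
  continuous (fun x => a * enorm (x - z) ^+ 2).
Proof.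
move=> x; have h := @continuous_enormB z x.
apply: (@cvgM _ _ (nbhs x) _ (fun=> a)); first exact: cvg_cst.
exact: (@cvgM _ _ (nbhs x) _ _ _ _ _ h h).
Qed.

Lemma continuous_dotB v z : continuous (fun x => dot v (x - z) : R).
Proof.
move=> x; apply/continuous_enormP => e e0.
have v0 : 0 < enorm v + 1 by rewrite ltr_wpDl.
exists (e / (enorm v + 1)) => [|y]; first by rewrite divr_gt0.
rewrite ltr_pdivlMr// mulrC -dotNr -dotDr opprB addrA subrK; apply: le_lt_trans.
by rewrite (le_trans (dot_abs_le _ _))// ler_wpM2r// lerDl.
Qed.

Lemma cvg_dot {T : Type} {F : set_system T} {FF : Filter F}
    (u v : T -> 'rV[R]_n) x y :
  u @ F --> x -> v @ F --> y -> (fun k => dot (u k) (v k)) @ F --> dot x y.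
Proof.
move=> ux vy; rewrite /dot; apply: cvg_big => [|i _]; first exact: add_continuous.
apply: cvgM.
  exact: (cvg_comp _ _ ux (@continuous_coord i x)).
exact: (cvg_comp _ _ vy (@continuous_coord i y)).
Qed.

Lemma cvg_enorm {T : Type} {F : set_system T} {FF : Filter F}
    (u : T -> 'rV[R]_n) x :
  u @ F --> x -> (fun k => enorm (u k)) @ F --> enorm x.
Proof.
move=> ux; apply: (cvg_comp _ _ (cvg_dot ux ux)); exact: sqrt_continuous.
Qed.

Lemma closed_enormP (S : set 'rV[R]_n) :
  (forall x, (forall e, 0 < e -> exists2 y, S y & enorm (y - x) < e) -> S x) ->
  closed S.
Proof.
move=> hS x clx; apply: hS => e e0.
have [|y [Sy yx]] := clx [set y | enorm (y - x) < e]; last by exists y.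
by apply/nbhs_enormP; exists e.
Qed.

Lemma compact_eball t : compact [set x : 'rV[R]_n | enorm x <= t].
Proof.
apply: bounded_closed_compact.
  exists t; split; first exact: num_real.
  move=> M tM x /= xt; rewrite (le_trans (normr_le_enorm _))//.
  by rewrite (le_trans xt)// ltW.
apply: closed_enormP => x hx; apply/ler_addgt0Pr => e /hx[y /= yt yx].
have := enormD (x - y) y; rewrite subrK (enormC x y) => /le_trans -> //.
by rewrite addrC lerD// ltW.
Qed.

(** Compactness of the ball in ultrafilter form: several bounded families converge along one and the
    same filter, which replaces successive extraction of subsequences. *)
Lemma bounded_ultra {T : Type} {F : set_system T} {FF : UltraFilter F}
    (u : T -> 'rV[R]_n) t : (forall k, enorm (u k) <= t) ->
  exists x, u @ F --> x.
Proof.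
move=> ut; have := @compact_eball t.
rewrite compact_ultra => cK; have [|x [_ ux]] := cK _ (fmap_ultra u FF).
  by apply: (@filterE _ F) => k /=.
by exists x.
Qed.

Lemma min_exists (S : set 'rV[R]_n) (h : 'rV[R]_n -> R) t :
  S !=set0 -> (forall x, S x -> enorm x <= t) -> closed S ->
  (forall x, S x -> {for x, continuous h}) ->
  exists2 x, S x & forall y, S y -> h x <= h y.
Proof.
move=> S0 St cS hc; have [|||x Sx xmin] := @EVT_min_rV R n h S.
- exact: S0.
- exact: (subclosed_compact cS (@compact_eball t)).
- by apply: continuous_in_subspaceT => x; rewrite inE => /hc.
- by exists x => [|y Sy]; [rewrite inE in Sx|apply: xmin; rewrite inE].
Qed.

End Euclid.
#[local] Hint Extern 0 (is_true (0 <= enorm _)) => solve [apply: enorm_ge0] : core.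

Local Notation dotE := (dotDl, dotDr, dotNl, dotNr, dotZl, dotZr).

Section Subgradients.
Context {R : realType} {n : nat}.
Implicit Types (x v u : 'rV[R]_n) (Psi : 'rV[R]_n -> \bar R).

Lemma nbhd_of_eball x (d : R) : 0 < d -> nbhd_of [set z | enorm (z - x) < d] x.
Proof. by move=> d0; exists d. Qed.

Lemma convex_eball x (d : R) : Defs.convex_set [set z | enorm (z - x) < d].
Proof.
move=> y z t /= yd zd /andP[t0 t1].
have -> : t *: y + (1 - t) *: z - x = t *: (y - x) + (1 - t) *: (z - x).
  by apply/rowP => i; rewrite !mxE; ring.
apply: (le_lt_trans (enormD _ _)); rewrite !enormZ !ger0_norm ?subr_ge0//.
have [->|tn0] := eqVneq t 0; first by rewrite mul0r add0r subr0 mul1r.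
have : t * enorm (y - x) < t * d by rewrite ltr_pM2l// lt_def tn0.
have : (1 - t) * enorm (z - x) <= (1 - t) * d by rewrite ler_wpM2l ?subr_ge0// ltW.
lra.
Qed.

Lemma lsubdiff_of_rsubdiff Psi x v : rsubdiff Psi x v -> lsubdiff Psi x v.
Proof.
move=> h; split; first by case: h.
exists (fun=> x), (fun=> v); split; first exact: cvg_cst.
by split; [exact: cvg_cst|split; [exact: cvg_cst|]].
Qed.

Lemma cvg_quadratic_minorant {S : Type} {F : set_system S} {FF : Filter F}
    (c : S -> R) (xk vk : S -> 'rV[R]_n) (c0 K : R) x v u :
  c @ F --> c0 -> xk @ F --> x -> vk @ F --> v ->
  (fun k => c k + dot (vk k) (u - xk k) - K * enorm (u - xk k) ^+ 2) @ F -->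
  c0 + dot v (u - x) - K * enorm (u - x) ^+ 2.
Proof.
move=> cc xx vv.
have ux : (fun k => u - xk k) @ F --> u - x by apply: cvgB => //; exact: cvg_cst.
have uxe : enorm (u - xk k) @[k --> F] --> enorm (u - x) by exact: cvg_enorm.
apply: cvgB; first by apply: cvgD => //; exact: cvg_dot.
apply: cvgM; first exact: cvg_cst.
exact: (@cvgM _ _ F _ _ _ _ _ uxe uxe).
Qed.

(** The subgradient inequality, valid near [x] up to a small linear error, is applied at a point of
    the segment towards [u]; convexity transfers it to [u], and dividing by [t] makes it global. *)
Lemma convex_rsubdiff Psi x v u :
  (forall t : R, 0 <= t <= 1 -> (Psi (t *: u + (1 - t) *: x)%R <=
     t%:E * Psi u + (1 - t)%:E * Psi x)%E) ->
  Psi u != -oo%E -> rsubdiff Psi x v ->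
  (Psi x + (dot v (u - x))%:E <= Psi u)%E.
Proof.
move=> cvx un [xfin sub].
case Eu: (Psi u) un cvx => [c| |]// _ cvx; last by rewrite leey.
case Ex: (Psi x) xfin sub cvx => [b| |]// _ sub cvx.
rewrite -EFinD lee_fin; apply/ler_addgt0Pr => e e0.
set D := enorm (u - x).
have D0 : 0 <= D by exact: enorm_ge0.
have D1 : 0 < D + 1 by rewrite ltr_wpDl.
have [d [d0 hd]] := sub _ (divr_gt0 e0 D1).
(* The step keeps the point within [d] of [x]; [D + 1] is positive even when [u = x]. *)
pose t := Num.min 1 (d / (2 * (D + 1))).
have t0 : 0 < t by rewrite lt_min ltr01 divr_gt0// mulr_gt0.
have t1 : t <= 1 by rewrite ge_min lexx.
have td : t * (2 * (D + 1)) <= d.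
  by rewrite -ler_pdivlMr ?mulr_gt0// ge_min lexx orbT.
have eu : t *: u + (1 - t) *: x - x = t *: (u - x).
  by apply/rowP => i; rewrite !mxE; ring.
have := hd (t *: u + (1 - t) *: x).
rewrite eu enormZ gtr0_norm// dotZr -/D.
have -> : t * D < d.
  by apply: lt_le_trans td; rewrite ltr_pM2l//; lra.
move=> /(_ isT) h; have := le_trans h (cvx t _).
rewrite (ltW t0) t1 => /(_ isT).
rewrite -!EFinM -!EFinD lee_fin => {}h.
rewrite -(ler_pM2l t0).
have eD : e / (D + 1) * (t * D) <= t * e.
  rewrite mulrCA ler_pM2l// mulrAC ler_pdivrMr// ler_pM2l//.
  by rewrite lerDl.
lra.
Qed.

End Subgradients.

(** * From pointwise monotonicity to quadratic growth *)

(** Real induction: the supremum of the [t] with [h 0 <= h t] belongs to that set, and monotonicity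
    around it pushes the set further unless the supremum is [b]. The radius [d] may vary with
    [t]. *)
Lemma locally_monotone_le {R : realType} (h : R -> R) (b : R) : 0 <= b ->
  (forall t, 0 <= t <= b -> exists2 d, 0 < d & forall s, 0 <= s <= b ->
     `|s - t| < d -> 0 <= (h s - h t) * (s - t)) ->
  h 0 <= h b.
Proof.
move=> b0 hl; pose S := [set t | 0 <= t <= b /\ h 0 <= h t].
have S0 : S 0 by split; rewrite ?lexx.
have Sb : ubound S b by move=> t [/andP[]].
have hS : has_sup S by split; [exists 0|exists b].
pose T := sup S.
have T0 : 0 <= T by exact: sup_upper_bound.
have Tb : T <= b by apply: ge_sup => //; exists 0.
have [|d d0 hd] := hl T; first by rewrite T0.
have [s Ss Ts] := sup_adherent d0 hS.
have sT : s <= T by exact: sup_upper_bound.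
have ST : h 0 <= h T.
  case: Ss => sb h0s; apply: (le_trans h0s).
  have [->//|sT'] := eqVneq s T.
  have := hd s sb; rewrite ltr_norml -/T in Ts *.
  have -> : - d < s - T < d by move: Ts sT d0; rewrite -/T; lra.
  move=> /(_ isT); have : s - T < 0 by rewrite subr_lt0 lt_neqAle sT' sT.
  nra.
have [->//|Tb'] := eqVneq b T.
have {}Tb' : T < b by rewrite lt_neqAle Tb andbT eq_sym.
pose u := Num.min (T + d / 2) b.
have Tu : T < u by rewrite lt_min Tb' andbT ltrDl divr_gt0.
have ub : u <= b by rewrite ge_min lexx orbT.
have uT : u <= T + d / 2 by rewrite ge_min lexx.
have Su : S u.
  split; first by rewrite ub andbT (le_trans T0)// ltW.
  apply: (le_trans ST).
  have := hd u; rewrite ub andbT (le_trans T0) ?(ltW Tu)// => /(_ isT).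
  have -> : `|u - T| < d by rewrite ltr_norml; lra.
  move=> /(_ isT); have : 0 < u - T by rewrite subr_gt0.
  nra.
by have := sup_upper_bound hS Su; rewrite leNgt Tu.
Qed.

Section VariationalConvexity.
Context {R : realType} {n : nat}.
Variables (f : 'rV[R]_n -> R) (G : set 'rV[R]_n) (xb : 'rV[R]_n).
Local Notation vec := 'rV[R]_n.

(** With [G := feasible s phi] this is convertible to [PhiNLP s f phi]; the variational arguments
    can thus be carried out for an abstract set [G]. *)
Definition constrained (x : vec) : \bar R :=
  if `[< G x >] then (f x)%:E else +oo%E.

Lemma constrained_in x : G x -> constrained x = (f x)%:E.
Proof. by move=> Gx; rewrite /constrained asboolT. Qed.

Lemma constrained_out x : ~ G x -> constrained x = +oo%E.
Proof. by move=> Gx; rewrite /constrained asboolF. Qed.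

Lemma constrained_fin x : constrained x \is a fin_num -> G x.
Proof.
by move=> h; apply: contrapT => /constrained_out E; rewrite E in h.
Qed.

Local Notation T := (rsubdiff constrained).

Lemma rsubdiff_constrained x v : T x v <->
  G x /\ forall eps, 0 < eps -> exists2 d, 0 < d & forall u, G u ->
    enorm (u - x) < d -> f x + dot v (u - x) - eps * enorm (u - x) <= f u.
Proof.
split=> [[/constrained_fin Gx h]|[Gx h]]; split=> //.
- move=> e /h[d [d0 hd]]; exists d => // u Gu /hd.
  by rewrite !constrained_in// lee_fin addrA.
- by rewrite constrained_in.
- move=> e /h[d d0 hd]; exists d; split=> // u ud.
  have [Gu|/constrained_out ->] := pselect (G u); last by rewrite leey.
  by rewrite !constrained_in// -EFinD lee_fin addrA hd.
Qed.

(** Within distance [e / (|K| + 1)] of [x] the quadratic error is at most [e] times the distance. *)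
Lemma rsubdiff_of_quadratic x v g K : G x -> enorm (x - xb) < g ->
  (forall u, G u -> enorm (u - xb) <= g ->
     f x + dot v (u - x) - K * enorm (u - x) ^+ 2 <= f u) -> T x v.
Proof.
move=> Gx xg h; apply/rsubdiff_constrained; split=> // e e0.
have K0 : 0 < `|K| + 1 by rewrite ltr_wpDl.
exists (Num.min (g - enorm (x - xb)) (e / (`|K| + 1))).
  by rewrite lt_min subr_gt0 xg divr_gt0.
move=> u Gu; rewrite lt_min ltr_pdivlMr// => /andP[ug uK].
apply: le_trans (h _ Gu _); last first.
  by rewrite (le_trans (enorm_trans u x xb))// -lerBrDr ltW.
have := enorm_ge0 (u - x); have := ler_norm K; move: uK.
set N := enorm _; set M := `|K|; set p := dot v _; nra.
Qed.

Variables (rho r sig : R).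
Hypotheses (rho0 : 0 < rho) (sig0 : 0 <= sig).
Hypothesis Gxb : G xb.
Hypothesis Gclosed : forall g, g < rho ->
  closed (G `&` [set x | enorm (x - xb) <= g]).
Hypothesis fcont : forall x, enorm (x - xb) < rho -> {for x, continuous f}.
Hypothesis T0 : T xb 0.
Hypothesis prox : forall x v u, T x v -> enorm (x - xb) < rho ->
  enorm v < rho -> G u -> enorm (u - xb) < rho ->
  f x + dot v (u - x) - r * enorm (u - x) ^+ 2 <= f u.
(** In contrast to [r] in [prox], the radius [d] depends on the base pair and on [e]; [growth]
    removes this dependence by integrating along a path. *)
Hypothesis monoT : forall x v e, T x v -> enorm (x - xb) < rho ->
  enorm v < rho -> 0 < e -> exists2 d, 0 < d & forall x' v', T x' v' ->
    enorm (x' - x) < d -> enorm (v' - v) < d ->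
    (sig - e) * enorm (x' - x) ^+ 2 <= dot (v' - v) (x' - x).

Lemma rsubdiff_mem x v : T x v -> G x.
Proof. by case/rsubdiff_constrained. Qed.

Lemma min_on_ball g (q : vec -> R) : 0 <= g -> g < rho -> continuous q ->
  exists p, [/\ G p, enorm (p - xb) <= g &
    forall u, G u -> enorm (u - xb) <= g -> f p + q p <= f u + q u].
Proof.
move=> g0 gr qc.
have [||||x [Gx xg] xmin] := @min_exists R n
  (G `&` [set x | enorm (x - xb) <= g]) (fun x => f x + q x) (g + enorm xb).
- by exists xb; split=> //=; rewrite subrr enorm0.
- move=> x [_ /= xg]; rewrite -{1}(subrK xb x) (le_trans (enormD _ _))//.
  by rewrite lerD2r.
- exact: Gclosed.
- move=> x [_ /= xg]; apply: continuousD; last exact: qc.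
  by apply: fcont; exact: le_lt_trans gr.
by exists x; split=> // u Gu ug; exact: xmin.
Qed.

(** [lam] is the proximal parameter, small against [r]. Proximal problems are solved over the ball
    of radius [g], for centres within [eta] of [xb]; the factors 10 keep the proximal points inside
    that ball and their subgradients below [rho]. *)
Variables (lam g eta : R).
Hypotheses (lam0 : 0 < lam) (lam1 : lam <= 1) (lamr : 4 * lam * r <= 1).
Hypotheses (eta0 : 0 < eta) (etag : 10 * eta <= g) (grho : g < rho)
  (etal : 10 * eta <= lam * rho).

(** With [D = x1 - x2], adding the two [prox] inequalities gives [<v1 - v2, D> >= - 2 r |D|^2]. As
    [4 lam r <= 1], the inner product of [D] with the difference of the centres is at least
    [|D|^2 / 2], and Cauchy-Schwarz concludes. *)
Lemma resolvent_lipschitz x1 v1 x2 v2 : T x1 v1 -> T x2 v2 ->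
  enorm (x1 - xb) < rho -> enorm v1 < rho ->
  enorm (x2 - xb) < rho -> enorm v2 < rho ->
  enorm (x1 - x2) <= 2 * enorm ((x1 + lam *: v1) - (x2 + lam *: v2)).
Proof.
move=> T1 T2 x1r v1r x2r v2r.
have := prox T1 x1r v1r (rsubdiff_mem T2) x2r.
have := prox T2 x2r v2r (rsubdiff_mem T1) x1r.
have := cauchy_schwarz ((x1 + lam *: v1) - (x2 + lam *: v2)) (x1 - x2).
rewrite (enormC x2 x1).
have -> : (x1 + lam *: v1) - (x2 + lam *: v2) =
    (x1 - x2) + lam *: (v1 - v2).
  by rewrite scalerBr opprD addrACA.
have -> : x2 - x1 = - (x1 - x2) by rewrite opprB.
set D := x1 - x2; set Z := D + _.
rewrite dotDl dotZl -enorm_sqr (dotDl v1) !dotNl dotNr.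
have := enorm_ge0 D; have := enorm_ge0 Z.
set a := enorm D; set b := enorm Z; set p := dot v1 D; set q := dot v2 D.
move=> b0 a0 h1 h2 h3.
have h4 : - (2 * r) * a ^+ 2 <= p - q by lra.
have h5 : - (2 * lam * r) * a ^+ 2 <= lam * (p - q).
  by have := ler_wpM2l (ltW lam0) h4; nra.
have h6 : a * a <= a * (2 * b).
  have := lamr; have := sqr_ge0 a; nra.
have [->|an0] := eqVneq a 0; first by rewrite mulr_ge0.
by rewrite -(@ler_pM2l _ a)// lt_def an0.
Qed.

(** [p] minimises the proximal objective over the ball of radius [g]. Comparison with [xb], where
    [prox] holds with subgradient [0], puts [p] well inside the ball; the minimality inequality,
    expanded around [p], is then a quadratic minorant with slope [lam^-1 *: (z - p)]. *)
Lemma resolvent_exists z : enorm (z - xb) < eta -> exists p,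
  [/\ T p (lam^-1 *: (z - p)), enorm (p - xb) <= 4 * enorm (z - xb),
      enorm (lam^-1 *: (z - p)) < rho &
      forall u, G u -> enorm (u - xb) <= g ->
        f p + (2 * lam)^-1 * enorm (p - z) ^+ 2 <=
        f u + (2 * lam)^-1 * enorm (u - z) ^+ 2].
Proof.
move=> zb; have zb0 := enorm_ge0 (z - xb).
have [|||p [Gp pg pmin]] := @min_on_ball g
    (fun u => (2 * lam)^-1 * enorm (u - z) ^+ 2).
- by move: etag eta0; lra.
- exact: grho.
- exact: continuous_sqr_enormB.
have l2 : 0 < (2 * lam)^-1 by rewrite invr_gt0 mulr_gt0.
have pz : enorm (p - xb) <= 4 * enorm (z - xb).
  have := prox T0 _ _ Gp (le_lt_trans pg grho).
  rewrite subrr enorm0 dot0l addr0 => /(_ rho0 rho0) h1.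
  have := pmin _ Gxb; rewrite subrr enorm0 => /(_ _)-h2.
  have {}h2 := h2 (ltW (lt_le_trans (mulr_gt0 (ltr0n _ 10) eta0) etag)).
  have h3 := enorm_trans p z xb.
  rewrite (enormC xb z) in h2.
  move: h1 h2 h3 (enorm_ge0 (p - z)) (enorm_ge0 (p - xb)) zb0.
  set A := enorm (p - xb); set B := enorm (z - xb); set C := enorm (p - z).
  move=> h1 h2 h3 C0 A0 B0.
  have h4 : (2 * lam)^-1 * C ^+ 2 <= (2 * lam)^-1 * B ^+ 2 + r * A ^+ 2 by lra.
  have h5 : C ^+ 2 <= B ^+ 2 + 2 * lam * r * A ^+ 2.
    have -> : B ^+ 2 + 2 * lam * r * A ^+ 2 =
        2 * lam * ((2 * lam)^-1 * B ^+ 2 + r * A ^+ 2).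
      by field; rewrite gt_eqF.
    have -> : C ^+ 2 = 2 * lam * ((2 * lam)^-1 * C ^+ 2).
      by field; rewrite gt_eqF.
    by rewrite ler_wpM2l// mulr_ge0// ltW.
  have := lamr; have := sqr_ge0 A; move=> A2 lr.
  have h6 : C ^+ 2 <= B ^+ 2 + A ^+ 2 / 2 by nra.
  (* Expanding [(A - B)^2 <= B^2 + A^2 / 2] leaves [A <= 4 B], the source of the factor 4. *)
  rewrite leNgt; apply/negP => h7.
  have h8 : A - B <= C by lra.
  have h9 : (A - B) ^+ 2 <= C ^+ 2 by rewrite ler_pXn2r// nnegrE; lra.
  nra.
have pg' : enorm (p - xb) < g by move: etag eta0; lra.
have vr : enorm (lam^-1 *: (z - p)) < rho.
  rewrite enormZ gtr0_norm ?invr_gt0// -(ltr_pM2l lam0).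
  rewrite mulVKf; last by rewrite gt_eqF.
  have := enorm_trans z xb p; rewrite (enormC xb p).
  by move: etal eta0; lra.
exists p; split=> //.
apply: (@rsubdiff_of_quadratic _ _ g (2 * lam)^-1) => // u Gu ug.
have := pmin u Gu ug.
have -> : u - z = (u - p) - (z - p) by rewrite opprB subrKA.
rewrite (enormC p z) !enorm_sqr dotZl !dotE (dotC z u) (dotC p u) (dotC p z).
suff -> : lam^-1 = 2 * (2 * lam)^-1 by lra.
by field; rewrite gt_eqF.
Qed.

(* [sig / (1 + lam * sig)] is the convexity modulus that the Moreau envelope
   with parameter [lam] inherits from the modulus [sig]. *)
Lemma moreau_modulus (a c : vec) :
  sig / (1 + lam * sig) * enorm (a + lam *: c) ^+ 2 <=
  sig * enorm a ^+ 2 + lam * enorm c ^+ 2.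
Proof.
have k0 : 0 < 1 + lam * sig by rewrite ltr_wpDr// mulr_ge0// ltW.
rewrite mulrAC ler_pdivrMr// -subr_ge0.
rewrite [leRHS](_ : _ = lam * enorm (c - sig *: a) ^+ 2).
  by rewrite mulr_ge0 ?sqr_ge0// ltW.
by rewrite !enorm_sqr !dotE (dotC c a); ring.
Qed.

Lemma moreau_step (v d : vec) t :
  (2 * lam)^-1 * enorm (- (lam *: v) + t *: d) ^+ 2 =
  (2 * lam)^-1 * enorm (- (lam *: v)) ^+ 2 - t * dot v d
  + (2 * lam)^-1 * (t ^+ 2 * enorm d ^+ 2).
Proof. by rewrite !enorm_sqr !dotE (dotC d v); field; rewrite gt_eqF. Qed.

(** The centre [z t] moves from [x' + lam v'] in direction [d], carrying the resolvent pair
    [(X t, V t)] and the envelope value [E t]. Integrating the pointwise monotonicity bounds the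
    slope of [E] from below, integrating again gives growth of [E], and [x] as a competitor at
    [t = 1] turns this into growth of [f]. *)
Lemma growth x' v' x : T x' v' -> enorm (x' - xb) < rho -> enorm v' < rho ->
  G x -> enorm (x - xb) <= g ->
  enorm (x' - xb) + lam * enorm v' + (1 + lam * sig) * enorm (x - x') < eta ->
  f x' + dot v' (x - x') + sig / 2 * enorm (x - x') ^+ 2 <= f x.
Proof.
move=> Tx' x'r v'r Gx xg small.
set kap := 1 + lam * sig in small.
have kap0 : 0 < kap by rewrite /kap ltr_wpDr// mulr_ge0// ltW.
set mu := sig / kap.
(* This multiple of [x - x'] optimises the final bound: undoing the envelope then returns exactly
   [sig / 2]. *)
pose d := kap *: (x - x').
have /choice[J hJ] : forall z, exists p, enorm (z - xb) < eta ->
    [/\ T p (lam^-1 *: (z - p)), enorm (p - xb) <= 4 * enorm (z - xb),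
      enorm (lam^-1 *: (z - p)) < rho &
      forall u, G u -> enorm (u - xb) <= g ->
        f p + (2 * lam)^-1 * enorm (p - z) ^+ 2 <=
        f u + (2 * lam)^-1 * enorm (u - z) ^+ 2].
  move=> z; have [/resolvent_exists[p hp]|_] := ltP (enorm (z - xb)) eta.
    by exists p.
  (* Dummy value outside the ball, where the implication is vacuous. *)
  by exists 0.
pose z t : vec := x' + lam *: v' + t *: d.
pose X t := J (z t); pose V t := lam^-1 *: (z t - X t).
have zb t : 0 <= t <= 1 -> enorm (z t - xb) < eta.
  move=> /andP[t0 t1]; apply: le_lt_trans small.
  rewrite /z addrAC (addrAC x') (le_trans (enormD _ _))// lerD//.
    by rewrite (le_trans (enormD _ _))// enormZ gtr0_norm.
  rewrite /d !enormZ ger0_norm// gtr0_norm// ler_piMl// mulr_ge0//.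
  exact: ltW.
have zXV t : z t = X t + lam *: V t.
  by rewrite /V scalerA divff ?gt_eqF// scale1r addrC subrK.
have zz s t : z s - z t = (s - t) *: d.
  by rewrite /z opprD addrACA subrr add0r scalerBl.
have hT t : 0 <= t <= 1 -> T (X t) (V t) by move=> /zb/hJ[].
have hV t : 0 <= t <= 1 -> enorm (V t) < rho by move=> /zb/hJ[].
have hXg t : 0 <= t <= 1 -> enorm (X t - xb) <= g.
  move=> /zb tb; have [_ h _ _] := hJ _ tb; apply: (le_trans h).
  by move: (etag) tb; have := enorm_ge0 (z t - xb); lra.
have hX t : 0 <= t <= 1 -> enorm (X t - xb) < rho.
  by move=> /hXg; move/le_lt_trans; apply.
have I0 : 0 <= (0 : R) <= 1 by rewrite lexx ler01.
have I1 : 0 <= (1 : R) <= 1 by rewrite ler01 lexx.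
(* [(X 0, V 0)] and [(x', v')] share the centre [z 0], and the Lipschitz bound leaves only one such
   pair. *)
have X0 : X 0 = x'.
  apply/eqP; rewrite -subr_eq0; apply/eqP/enorm_eq0/eqP.
  rewrite eq_le enorm_ge0 andbT.
  have := resolvent_lipschitz (hT 0 I0) Tx' (hX _ I0) (hV _ I0) x'r v'r.
  by rewrite -zXV /z scale0r addr0 subrr enorm0 mulr0.
have V0 : V 0 = v'.
  by rewrite /V X0 /z scale0r addr0 addrAC subrr add0r scalerA mulVf ?gt_eqF// scale1r.
have lipX s t : 0 <= s <= 1 -> 0 <= t <= 1 ->
    enorm (X s - X t) <= 2 * (`|s - t| * enorm d).
  move=> sI tI.
  have := resolvent_lipschitz (hT s sI) (hT t tI) (hX _ sI) (hV _ sI) (hX _ tI) (hV _ tI).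
  by rewrite -!zXV zz enormZ.
have zXVB s t : (s - t) *: d = (X s - X t) + lam *: (V s - V t).
  by rewrite -zz !zXV scalerBr opprD addrACA.
have lipV s t : 0 <= s <= 1 -> 0 <= t <= 1 ->
    enorm (V s - V t) <= lam^-1 * (3 * (`|s - t| * enorm d)).
  move=> sI tI; rewrite -(ler_pM2l lam0) mulVKf ?gt_eqF//.
  rewrite -{1}(gtr0_norm lam0) -enormZ.
  have -> : lam *: (V s - V t) = (s - t) *: d - (X s - X t).
    by rewrite zXVB addrAC subrr add0r.
  rewrite (le_trans (enormB _ _))// enormZ.
  by have := lipX s t sI tI; lra.
(* [moreau_modulus] converts the modulus [sig] along [X] into [mu] along [z]; the loss [4 * e] is
   [e] times the square of the Lipschitz constant 2 of [X]. *)
have theta e t : 0 < e -> 0 <= t <= 1 ->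
    (mu - 4 * e) * t * enorm d ^+ 2 <= dot (V t - v') d.
  move=> e0 /andP[t0 t1].
  pose th t := dot (V t) d - (mu - 4 * e) * t * enorm d ^+ 2.
  suff : th 0 <= th t.
    by rewrite /th V0 mulr0 mul0r subr0 dotDl dotNl; lra.
  apply: locally_monotone_le => // s /andP[s0 st].
  have sI : 0 <= s <= 1 by rewrite s0 (le_trans st).
  have [d0 d0p hd] := monoT (hT s sI) (hX s sI) (hV s sI) e0.
  (* Dominates the Lipschitz constants of both [X] and [V] in the parameter, so a step below
     [d0 / c] stays in the range of [monoT]. *)
  pose c := (2 + lam^-1 * 3) * (enorm d + 1).
  have l1 : 0 < lam^-1 * 3 by rewrite mulr_gt0// invr_gt0.
  have c0 : 0 < c by apply: mulr_gt0; [exact: addr_gt0|rewrite ltr_wpDl].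
  exists (d0 / c); first by rewrite divr_gt0.
  move=> w /andP[w0 wt]; rewrite ltr_pdivlMr// => wc.
  have wI : 0 <= w <= 1 by rewrite w0 (le_trans wt).
  have m0 : 0 <= `|w - s| by [].
  have hX' : enorm (X w - X s) < d0.
    apply: (le_lt_trans (lipX _ _ wI sI)); apply: le_lt_trans wc.
    rewrite mulrCA ler_wpM2l// /c.
    by move: (lam^-1 * 3) (l1) (enorm_ge0 d) => L L0; nra.
  have hV' : enorm (V w - V s) < d0.
    apply: (le_lt_trans (lipV _ _ wI sI)); apply: le_lt_trans wc.
    rewrite (_ : lam^-1 * _ = `|w - s| * (lam^-1 * 3 * enorm d)); last by ring.
    rewrite ler_wpM2l// /c.
    by move: (lam^-1 * 3) (l1) (enorm_ge0 d) => L L0; nra.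
  have := hd _ _ (hT w wI) hX' hV'.
  have := moreau_modulus (X w - X s) (V w - V s).
  rewrite -zXVB enormZ exprMn real_normK ?num_real// -/kap -/mu.
  have : enorm (X w - X s) ^+ 2 <= 4 * ((w - s) ^+ 2 * enorm d ^+ 2).
    rewrite (_ : 4 * _ = (2 * (`|w - s| * enorm d)) ^+ 2).
      by rewrite ler_pXn2r ?nnegrE ?mulr_ge0// lipX.
    by rewrite -(@real_normK _ (w - s)) ?num_real//; ring.
  have : (w - s) * dot (V w - V s) d =
      dot (V w - V s) (X w - X s) + lam * enorm (V w - V s) ^+ 2.
    by rewrite -dotZr zXVB dotDr dotZr enorm_sqr.
  rewrite /th -[dot (V w) d](subrK (dot (V s) d)) -dotNl -dotDl.
  move: (enorm (V w - V s) ^+ 2) (enorm (X w - X s) ^+ 2) (enorm d ^+ 2).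
  move: (dot (V w - V s) _) (dot (V w - V s) _) (dot (V s) d) => p q p' B A D.
  move=> h1 h2 h3 h4.
  have := ler_wpM2l (ltW e0) h2; nra.
pose E t := f (X t) + (2 * lam)^-1 * enorm (X t - z t) ^+ 2.
(* [X s] is a competitor in the proximal problem with centre [z t]: this is a one-sided first-order
   expansion of the envelope with slope [V s]. *)
have Estep s t : 0 <= s <= 1 -> 0 <= t <= 1 ->
    (s - t) * dot (V s) d - (2 * lam)^-1 * ((s - t) ^+ 2 * enorm d ^+ 2)
    <= E s - E t.
  move=> sI tI; have [_ _ _ h] := hJ _ (zb _ tI).
  have {h} := h _ (rsubdiff_mem (hT s sI)) (hXg s sI).
  rewrite -/(X t) -/(E t) /E.
  have -> : X s - z t = (X s - z s) + (s - t) *: d.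
    by rewrite -zz addrA subrK.
  have -> : X s - z s = - (lam *: V s) by rewrite {1}zXV opprD addrA subrr add0r.
  by rewrite moreau_step; lra.
have Egrow : E 0 + dot v' d + mu / 2 * enorm d ^+ 2 <= E 1.
  apply/ler_addgt0Pr => e e0.
  have D0 : 0 <= enorm d ^+ 2 by exact: sqr_ge0.
  (* The term [e * t] absorbs the quadratic error of [Estep], which makes [Psi] locally
     nondecreasing. *)
  pose Psi t := E t - t * dot v' d - mu / 2 * t ^+ 2 * enorm d ^+ 2 + e * t.
  suff : Psi 0 <= Psi 1.
    by rewrite /Psi !mul0r !mul1r !mulr0 expr0n expr1n/= mulr0 mul0r !mulr1; lra.
  have thm t : 0 <= t <= 1 -> mu * t * enorm d ^+ 2 <= dot (V t - v') d.
    move=> tI; apply/ler_addgt0Pr => e' e'0.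
    pose e'' := e' / (4 * (enorm d ^+ 2 + 1)).
    have e''0 : 0 < e'' by rewrite divr_gt0// mulr_gt0// ltr_wpDl.
    have := theta e'' t e''0 tI.
    have : e'' * (4 * (enorm d ^+ 2 + 1)) = e'.
      by rewrite /e'' divfK// gt_eqF// mulr_gt0// ltr_wpDl.
    move: tI => /andP[t0 t1]; move: (enorm d ^+ 2) D0 => D D0.
    have : t * (e'' * D) <= e'' * D by rewrite ler_piMl// mulr_ge0// ltW.
    nra.
  pose c := (2 * lam)^-1 * enorm d ^+ 2 + mu / 2 * enorm d ^+ 2 + 1.
  have mu0 : 0 <= mu by rewrite divr_ge0// ltW.
  have L0 : 0 <= (2 * lam)^-1 by rewrite invr_ge0 mulr_ge0// ltW.
  have c0 : 0 < c.
    by rewrite ltr_wpDl// addr_ge0//; apply: mulr_ge0 => //; exact: divr_ge0.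
  have key s t : 0 <= s <= 1 -> 0 <= t <= 1 -> t <= s -> s - t < e / c ->
      Psi t <= Psi s.
    move=> sI tI ts; rewrite ltr_pdivlMr// /c.
    have := Estep s t sI tI; have := thm s sI; rewrite dotDl dotNl /Psi.
    move: ts; rewrite -subr_ge0.
    move: ((2 * lam)^-1) L0 (enorm d ^+ 2) D0 (dot (V s) d) (dot v' d) (E s) (E t).
    move=> L L0 D D0 p q Es Et st h1 h2 h3.
    have h4 : (s - t) * (mu * s * D) <= (s - t) * (p + - q) by rewrite ler_wpM2l.
    have h5 : (s - t) * ((s - t) * (L * D + mu / 2 * D + 1)) <= (s - t) * e.
      by rewrite ler_wpM2l// ltW.
    have h6 : 0 <= (s - t) * (s - t) by rewrite mulr_ge0.
    have h7 : 0 <= (s - t) * (s - t) * (mu * D) by rewrite mulr_ge0// mulr_ge0.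
    lra.
  apply: locally_monotone_le => // t tI; exists (e / c); first by rewrite divr_gt0.
  move=> s sI; have [ts|st] := leP t s.
    by rewrite ger0_norm ?subr_ge0// => h; rewrite mulr_ge0 ?subr_ge0//; exact: key.
  rewrite ltr0_norm ?subr_lt0// opprB => h.
  by rewrite mulr_le0// subr_le0; [apply: key => //; exact: ltW|exact: ltW].
have [_ _ _ h] := hJ _ (zb _ I1); have {h} := h _ Gx xg.
rewrite -/(X 1) -/(E 1) => /(le_trans Egrow).
rewrite /E X0 /z scale1r scale0r addr0.
have -> : x' - (x' + lam *: v') = - (lam *: v') by rewrite opprD addrA subrr add0r.
have -> : x - (x' + lam *: v' + d) =
    (x - x') - d - lam *: v'.
  by rewrite !opprD !addrA addrAC.
rewrite /d; move: (x - x') => D.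
rewrite !enorm_sqr !dotE (dotC v' D) => h.
rewrite -subr_ge0; move: h; rewrite -subr_ge0 => h; apply: (le_trans h).
rewrite le_eqVlt; apply/orP; left; apply/eqP.
by rewrite /mu; move: kap0; rewrite /kap => kap0; field; rewrite !gt_eqF.
Qed.

(** The [prox] inequality holds with a common [r] along the approximating sequence, so it passes to
    the limit: near [(xb, 0)] limiting subgradients are regular. *)
Lemma lsubdiff_constrained x v : enorm (x - xb) < rho -> enorm v < rho ->
  lsubdiff constrained x v -> T x v.
Proof.
move=> xr vr [/constrained_fin Gx [xk [vk [xkx [_ [vkv Tk]]]]]].
apply: (@rsubdiff_of_quadratic _ _ ((enorm (x - xb) + rho) / 2) r) => //.
  by rewrite ltr_pdivlMr//; lra.
move=> u Gu ug.
have ur : enorm (u - xb) < rho by apply: (le_lt_trans ug); rewrite ltr_pdivrMr//; lra.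
have fxk : (fun k => f (xk k)) @ \oo --> f x.
  exact: (cvg_comp _ _ xkx (fcont xr)).
have lim := @cvg_quadratic_minorant R n _ \oo _ _ _ _ _ r _ _ u fxk xkx vkv.
apply: (@cvgr_to_le _ _ _ R _ _ _ (lim _)).
have /cvg_enormP/(_ (rho - enorm (x - xb)))/[!subr_gt0]/(_ xr) hx := xkx.
have /cvg_enormP/(_ (rho - enorm v))/[!subr_gt0]/(_ vr) hv := vkv.
near=> k; apply: (prox (Tk k)) => //.
- have : enorm (xk k - x) < rho - enorm (x - xb) by near: k.
  by have := enorm_trans (xk k) x xb; lra.
- have : enorm (vk k - v) < rho - enorm v by near: k.
  by have := enormD (vk k - v) v; rewrite subrK; lra.
Unshelve. all: by end_near. Qed.

(** The smallness condition of [growth] couples three quantities; within radius [a] their sum stays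
    below [4 (1 + lam sig) a], hence below [eta]. *)
Lemma growth_near : exists a, [/\ 0 < a, a <= 1, a <= rho &
  forall x' v' x, T x' v' -> enorm (x' - xb) < a -> enorm v' < a ->
    G x -> enorm (x - xb) < a ->
    f x' + dot v' (x - x') + sig / 2 * enorm (x - x') ^+ 2 <= f x].
Proof.
have ls0 : 0 <= lam * sig by rewrite mulr_ge0// ltW.
have k0 : 0 < 4 * (1 + lam * sig) by rewrite mulr_gt0// ltr_wpDr.
exists (Num.min 1 (eta / (4 * (1 + lam * sig)))).
have ae : Num.min 1 (eta / (4 * (1 + lam * sig))) * (4 * (1 + lam * sig)) <= eta.
  by rewrite -ler_pdivlMr// ge_min lexx orbT.
have a0 : 0 < Num.min 1 (eta / (4 * (1 + lam * sig))).
  by rewrite lt_min ltr01 divr_gt0.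
have a1 : Num.min 1 (eta / (4 * (1 + lam * sig))) <= 1 by rewrite ge_min lexx.
move: (Num.min _ _) ae a0 a1 => a ae a0 a1.
have aeta : a <= eta by move: ls0 a0 ae; move: (lam * sig) => ls; nra.
have ag : a <= g by move: etag; lra.
have arho : a < rho by exact: le_lt_trans grho.
split=> //; first exact: ltW.
move=> x' v' x Tx' x'a v'a Gx xa.
apply: growth => //; [exact: lt_trans arho|exact: lt_trans arho| |].
  by rewrite (le_trans (ltW xa)).
have xx' : enorm (x - x') < 2 * a.
  by have := enorm_trans x xb x'; rewrite (enormC xb x'); lra.
have lv : lam * enorm v' <= enorm v' by rewrite ler_piMl.
have : (1 + lam * sig) * enorm (x - x') < (1 + lam * sig) * (2 * a).
  by rewrite ltr_pM2l// ltr_wpDr.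
have := mulr_ge0 ls0 (ltW a0); lra.
Qed.

End VariationalConvexity.

(** * The convex minorant and tilt stability *)

Section ConvexMinorant.
Context {R : realType} {n : nat}.
Local Notation vec := 'rV[R]_n.
Variables (f : vec -> R) (G : set vec) (xb : vec).
Local Notation Phi := (constrained f G).
Local Notation T := (rsubdiff Phi).
Variables (sig a lam eta : R).
Hypotheses (sig0 : 0 <= sig) (a0 : 0 < a) (a1 : a <= 1).
Hypotheses (lam0 : 0 < lam) (lam1 : lam <= 1) (eta0 : 0 < eta).
Hypothesis T0 : T xb 0.
Hypothesis growth : forall x' v' x, T x' v' -> enorm (x' - xb) < a ->
  enorm v' < a -> G x -> enorm (x - xb) < a ->
  f x' + dot v' (x - x') + sig / 2 * enorm (x - x') ^+ 2 <= f x.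
Hypothesis resolvent : forall z, enorm (z - xb) < eta -> exists2 p,
  T p (lam^-1 *: (z - p)) & enorm (p - xb) <= 4 * enorm (z - xb).
Hypothesis lsubdiff_T : forall x v, enorm (x - xb) < a -> enorm v < a ->
  lsubdiff Phi x v -> T x v.

Let minorant (p : vec * vec) (x : vec) : R :=
  f p.1 + dot p.2 (x - p.1) + sig / 2 * enorm (x - p.1) ^+ 2.

Let graph := [set p : vec * vec |
  [/\ T p.1 p.2, enorm (p.1 - xb) < a & enorm p.2 < a]].

Let psi (x : vec) : \bar R := ereal_sup [set (minorant p x)%:E | p in graph].

Let graph_xb : graph (xb, 0).
Proof. by split; rewrite //= ?subrr enorm0. Qed.

Let psi_ge p x : graph p -> ((minorant p x)%:E <= psi x)%E.
Proof. by move=> gp; apply: ereal_sup_ubound; exists p. Qed.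

Let psi_neqNy x : psi x != -oo%E.
Proof.
by apply/eqP => h; have := psi_ge x graph_xb; rewrite h.
Qed.

Let psi_le x : enorm (x - xb) < a -> (psi x <= Phi x)%E.
Proof.
move=> xa; apply: ge_ereal_sup => _ [p [Tp pa va] <-].
have [Gx|/constrained_out ->] := pselect (G x); last by rewrite leey.
by rewrite constrained_in// lee_fin growth.
Qed.

(** The growth inequality bounds [psi] from above by [f], and the minorant based at [(x, v)] itself
    attains [f x]. *)
Let psi_eq x v : T x v -> enorm (x - xb) < a -> enorm v < a ->
  psi x = (f x)%:E.
Proof.
move=> Tx xa va; apply/eqP; rewrite eq_le.
rewrite -(constrained_in f (rsubdiff_mem Tx)) psi_le//=.
rewrite (constrained_in f (rsubdiff_mem Tx)).
have := @psi_ge (x, v) x (And3 Tx xa va).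
by rewrite /minorant/= subrr dot0r enorm0 expr0n/= mulr0 !addr0.
Qed.

(** A quadratic of curvature [sig] satisfies the strong convexity inequality with equality, and a
    supremum of such functions inherits the inequality. *)
Let psi_convex x y t : 0 <= t <= 1 ->
  (psi (t *: x + (1 - t) *: y)%R <= t%:E * psi x + (1 - t)%:E * psi y
    - (sig / 2 * t * (1 - t) * enorm (x - y) ^+ 2)%:E)%E.
Proof.
move=> /andP[t0 t1]; apply: ge_ereal_sup => _ [p gp <-].
rewrite leeBrDr//.
have -> : ((minorant p (t *: x + (1 - t) *: y))%:E +
    (sig / 2 * t * (1 - t) * enorm (x - y) ^+ 2)%:E =
    t%:E * (minorant p x)%:E + (1 - t)%:E * (minorant p y)%:E)%E.
  rewrite -!EFinM -!EFinD; congr (_%:E); rewrite /minorant.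
  have -> : t *: x + (1 - t) *: y - p.1 = t *: (x - p.1) + (1 - t) *: (y - p.1).
    by apply/rowP => i; rewrite !mxE; ring.
  have -> : x - y = (x - p.1) - (y - p.1) by rewrite opprB addrA subrK.
  move: (x - p.1) (y - p.1) => u w.
  by rewrite !enorm_sqr !dotE (dotC w u); ring.
apply: leeD; apply: lee_wpmul2l; rewrite ?lee_fin ?subr_ge0//; exact: psi_ge.
Qed.

Let psi_lsc (U : set vec) : lsc_on psi U.
Proof.
move=> x _ c /ereal_sup_gt[_ [p gp <-]]; rewrite lte_fin => cp.
have mc : {for x, continuous (minorant p)}.
  rewrite /minorant; apply: (@cvgD _ _ _ (nbhs x)).
    apply: (@cvgD _ _ _ (nbhs x)); first exact: cvg_cst.
    exact: continuous_dotB.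
  exact: continuous_sqr_enormB.
rewrite -subr_gt0 in cp; have [d d0 hd] := (continuous_enormP _ _).1 mc _ cp.
exists d; split=> // u /hd; rewrite ltr_norml => /andP[h _].
by apply: lt_le_trans (psi_ge u gp); rewrite lte_fin; lra.
Qed.

(** Convexity makes the inequality of a regular subgradient global, and in this form it survives the
    limits in [lsubdiff]. *)
Let psi_subgradient x v u : lsubdiff psi x v ->
  (psi x + (dot v (u - x))%:E <= psi u)%E.
Proof.
have cvx y : forall t : R, 0 <= t <= 1 ->
    (psi (t *: u + (1 - t) *: y)%R <= t%:E * psi u + (1 - t)%:E * psi y)%E.
  move=> t t01; apply: (le_trans (psi_convex u y t01)).
  rewrite leeBlDr// leeDl// lee_fin; case/andP: t01 => t0 t1.
  by rewrite !mulr_ge0 ?subr_ge0// ?invr_ge0// sqr_ge0.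
move=> [xfin [xk [vk [xkx [pk [vkv Tk]]]]]].
case E: (psi u) => [c| |]; [|by rewrite leey|by have := psi_neqNy u; rewrite E].
case Ex: (psi x) xfin => [b| |]// _; rewrite -EFinD lee_fin.
have fk : (fun k => fine (psi (xk k))) @ \oo --> b.
  by apply: fine_cvg; rewrite -Ex.
have lim := @cvg_quadratic_minorant R n _ \oo _ _ _ _ _ 0 _ _ u fk xkx vkv.
have -> : b + dot v (u - x) = b + dot v (u - x) - 0 * enorm (u - x) ^+ 2.
  by rewrite mul0r subr0.
apply: (@cvgr_to_le _ _ _ R _ _ _ (lim _)); near=> k.
have := convex_rsubdiff (cvx (xk k)) (psi_neqNy u) (Tk k).
rewrite E mul0r subr0; case: (Tk k) => xkf _.
by rewrite -{1}(fineK xkf) -EFinD lee_fin.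
Unshelve. all: by end_near. Qed.

(** A subgradient of [Phi] is one of [psi] because its own minorant touches at [x]. Conversely, as
    in Minty's argument, a subgradient [v] of [psi] at [x] is compared with the resolvent pair
    [(p, w)] of the centre [x + lam v]; monotonicity forces [(p, w) = (x, v)]. *)
Lemma var_convex_of_growth : var_convex_mod sig Phi xb 0.
Proof.
(* The centre [x + lam v] is within [2 d] of [xb], the point [p] within [8 d], and [lam w] has norm
   at most [10 d]; the factor 20 keeps these below [eta], [a] and [lam a]. *)
pose d := Num.min eta (lam * a) / 20.
have d0 : 0 < d by rewrite divr_gt0// lt_min eta0 mulr_gt0.
have deta : 20 * d <= eta by rewrite mulrC divfK// ge_min lexx.
have dlam : 20 * d <= lam * a by rewrite mulrC divfK// ge_min lexx orbT.
have la : lam * a <= a by rewrite ler_piMl// ltW.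
have da : d < a by lra.
split; first exact: lsubdiff_of_rsubdiff.
(* The level [1] suffices: on these neighbourhoods [f] exceeds [f xb] by at most [|v| |x - xb| < 1]
   at points of the graph. *)
exists [set x | enorm (x - xb) < d], [set v | enorm (v - 0) < d], 1, psi.
do 4?[split; [by [exact: nbhd_of_eball|exact: convex_eball]|]].
split; first exact: ltr01.
split; first exact: psi_lsc.
split; first by split=> [x _|x y t _ _]; [exact: psi_neqNy|exact: psi_convex].
split=> [x /= xd|x v]; first by apply: psi_le; exact: lt_trans da.
have Tpsi : enorm (x - xb) < d -> enorm v < d -> lsubdiff Phi x v ->
    T x v /\ psi x = (f x)%:E.
  move=> xd vd Lx; have Tx : T x v.
    by apply: lsubdiff_T => //; exact: lt_trans da.
  by split=> //; apply: (psi_eq Tx); exact: lt_trans da.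
rewrite /= subr0; split; last first.
  move=> [xd [_ [vd Lx]]]; have [Tx ->] := Tpsi xd vd Lx.
  by rewrite constrained_in//; exact: rsubdiff_mem Tx.
split=> [[[xd _] [vd Lx]]|[xd [vd Lx]]].
  have [Tx psix] := Tpsi xd vd Lx.
  split=> //; split=> //; apply: lsubdiff_of_rsubdiff; split; first by rewrite psix.
  move=> e e0; exists 1; split=> // u _; rewrite psix.
  apply: le_trans (@psi_ge (x, v) u _).
    rewrite -EFinD lee_fin /minorant/=.
    have := mulr_ge0 (ltW e0) (enorm_ge0 (u - x)).
    have := mulr_ge0 (divr_ge0 sig0 (ler0n _ 2)) (sqr_ge0 (enorm (u - x))).
    by lra.
  by split=> //=; exact: lt_trans da.
have zb : enorm (x + lam *: v - xb) < 2 * d.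
  rewrite addrAC (le_lt_trans (enormD _ _))// enormZ gtr0_norm//.
  have : lam * enorm v <= enorm v by rewrite ler_piMl.
  lra.
have [|p Tp pb] := @resolvent (x + lam *: v); first by lra.
set w := lam^-1 *: _ in Tp.
have pa : enorm (p - xb) < a by lra.
have lw : lam *: w = x + lam *: v - p.
  by rewrite /w scalerA divff ?gt_eqF// scale1r.
have wa : enorm w < a.
  rewrite -(ltr_pM2l lam0) -[in ltLHS](gtr0_norm lam0) -enormZ lw.
  by have := enorm_trans (x + lam *: v) xb p; rewrite (enormC xb p); lra.
have := psi_subgradient p Lx; rewrite (psi_eq Tp pa wa).
have := @psi_ge (p, w) x (And3 Tp pa wa).
case: (Lx) => xfin _; case Ex: (psi x) xfin => [b| |]// _.
rewrite -EFinD !lee_fin /minorant/= => h1 h2.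
(* The two minorant inequalities add up to [<v - w, p - x> <= 0], while [p - x = lam (v - w)]. *)
have px : p = x.
  apply/eqP; rewrite -subr_eq0; apply/eqP/enorm_eq0/eqP.
  rewrite -sqrf_eq0 eq_le sqr_ge0 andbT enorm_sqr.
  have {2}-> : p - x = lam *: (v - w).
    by rewrite scalerBr lw opprB addrA addrC; apply/rowP => i; rewrite !mxE; ring.
  rewrite dotZr pmulr_rle0// dotC dotDl dotNl.
  have := mulr_ge0 (divr_ge0 sig0 (ler0n _ 2)) (sqr_ge0 (enorm (x - p))).
  move: h1; rewrite -(opprB p x) dotNr enormN; lra.
have wv : w = v.
  apply: (@scalerI _ _ lam); first by rewrite gt_eqF.
  by rewrite lw px addrAC subrr add0r.
rewrite px wv in Tp; split; last by split=> //; exact: lsubdiff_of_rsubdiff.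
split=> //; have Gx := rsubdiff_mem Tp; have Gxb := rsubdiff_mem T0.
rewrite !constrained_in// -EFinD lte_fin.
have := growth Tp (lt_trans xd da) (lt_trans vd da) Gxb.
rewrite subrr enorm0 => /(_ a0).
have := mulr_ge0 (divr_ge0 sig0 (ler0n _ 2)) (sqr_ge0 (enorm (xb - x))).
have := dot_abs_le v (xb - x); rewrite ler_norml (enormC xb x) => /andP[h _].
have : enorm v * enorm (x - xb) < 1.
  have d1 : d < 1 by exact: lt_le_trans da a1.
  apply: le_lt_trans (mulr_ilt1 (ltW d0) (ltW d0) d1 d1).
  by apply: ler_pM => //; exact: ltW.
lra.
Qed.

Lemma strong_growth x : G x -> enorm (x - xb) < a ->
  f xb + sig / 2 * enorm (x - xb) ^+ 2 <= f x.
Proof.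
move=> Gx xa; have := growth T0 _ _ Gx xa; rewrite subrr enorm0 dot0l addr0.
exact.
Qed.

Lemma local_min_of_growth : local_min Phi xb.
Proof.
exists a; split=> // x xa.
have [Gx|/constrained_out ->] := pselect (G x); last by rewrite leey.
rewrite !constrained_in//; last exact: rsubdiff_mem T0.
rewrite lee_fin; apply: le_trans (strong_growth Gx xa).
by rewrite lerDl mulr_ge0 ?divr_ge0 ?sqr_ge0.
Qed.

Lemma strong_local_min_of_growth : 0 < sig -> strong_local_min Phi xb.
Proof.
move=> s0; exists (sig / 2), a; split; first by rewrite divr_gt0.
split=> // x xa.
have [Gx|/constrained_out ->] := pselect (G x); last by rewrite leey.
rewrite !constrained_in//; last exact: rsubdiff_mem T0.
by rewrite -EFinD lee_fin strong_growth.
Qed.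

Lemma strongly_monotone x1 v1 x2 v2 : T x1 v1 -> T x2 v2 ->
  enorm (x1 - xb) < a -> enorm v1 < a -> enorm (x2 - xb) < a -> enorm v2 < a ->
  sig * enorm (x1 - x2) ^+ 2 <= dot (v1 - v2) (x1 - x2).
Proof.
move=> T1 T2 x1a v1a x2a v2a.
have := growth T1 x1a v1a (rsubdiff_mem T2) x2a.
have := growth T2 x2a v2a (rsubdiff_mem T1) x1a.
by rewrite (enormC x2 x1) -(opprB x1 x2) dotNr (dotDl v1) dotNl; lra.
Qed.

Hypothesis min_linear : forall g v, 0 < g -> g < a -> exists p,
  [/\ G p, enorm (p - xb) <= g & forall u, G u -> enorm (u - xb) <= g ->
    f p - dot v p <= f u - dot v u].

(** For small [v], growth at [xb] keeps the minimisers off the boundary of the ball, so [v] is a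
    subgradient at each of them; strong monotonicity then yields both uniqueness and the Lipschitz
    constant [sig^-1]. *)
Lemma tilt_stable_of_growth : 0 < sig -> tilt_stable sig^-1 Phi xb.
Proof.
move=> s0; have Gxb := rsubdiff_mem T0.
split; first by rewrite constrained_in.
exists (a / 2); have g0 : 0 < a / 2 by rewrite divr_gt0.
have ga : a / 2 < a by lra.
split=> //.
(* A minimiser at distance at least [a / 2] from [xb] would force [|v| >= sig a / 4]. *)
pose delta := Num.min a (sig * a / 4).
have delta0 : 0 < delta by rewrite lt_min a0 divr_gt0// mulr_gt0.
have da (v : vec) : enorm v < delta -> enorm v < a by rewrite lt_min => /andP[].
have ds (v : vec) : enorm v < delta -> 4 * enorm v < sig * a.
  by rewrite lt_min ltr_pdivlMr// mulrC => /andP[].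
have argminE v x : tilt_argmin Phi xb (a / 2) v x <->
    [/\ G x, enorm (x - xb) <= a / 2 & forall u, G u ->
      enorm (u - xb) <= a / 2 -> f x - dot v x <= f u - dot v u].
  split=> [[xg xmin]|[Gx xg xmin]].
    have Gx : G x.
      apply: contrapT => /constrained_out E.
      have := xmin xb; rewrite subrr enorm0 E (constrained_in f Gxb).
      by move=> /(_ (ltW g0)); rewrite -EFinB.
    split=> // u Gu /xmin; rewrite !constrained_in//.
  split=> // u ug.
  have [Gu|/constrained_out ->] := pselect (G u); last by rewrite leey.
  by rewrite !constrained_in// -!EFinB lee_fin xmin.
have argminT v x : enorm v < delta -> tilt_argmin Phi xb (a / 2) v x ->
    T x v /\ enorm (x - xb) < a.
  move=> vd /argminE[Gx xg xmin]; have xa := le_lt_trans xg ga.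
  split=> //; apply: (@rsubdiff_of_quadratic _ _ _ _ xb _ _ (a / 2) 0) => //.
    have := xmin xb Gxb; rewrite subrr enorm0 => /(_ (ltW g0)) h1.
    have h2 := strong_growth Gx xa.
    have h3 := cauchy_schwarz v (x - xb); rewrite dotDr dotNr in h3.
    have h4 := ds v vd.
    rewrite ltNge; apply/negP => h5; move: h1 h2 h3 h4 h5.
    have := enorm_ge0 v.
    move: (enorm (x - xb)) (enorm v) (dot v x) (dot v xb) => A B p q B0 h1 h2 h3 h4 h5.
    have A0 : 0 < A by exact: lt_le_trans g0 h5.
    have h6 : sig / 2 * A ^+ 2 <= B * A by lra.
    have h7 : sig / 2 * A <= B by rewrite -(ler_pM2r A0); nra.
    have h8 : sig * (a / 2) <= sig * A by rewrite ler_pM2l.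
    lra.
  move=> u Gu ug; have := xmin u Gu ug.
  by rewrite dotDr dotNr mul0r subr0; lra.
have /choice[M0 hM0] : forall v, exists p, tilt_argmin Phi xb (a / 2) v p.
  by move=> v; have [p hp] := min_linear v g0 ga; exists p; apply/argminE.
have uniq v x y : enorm v < delta -> tilt_argmin Phi xb (a / 2) v x ->
    tilt_argmin Phi xb (a / 2) v y -> x = y.
  move=> vd /(argminT _ _ vd)[Tx xa] /(argminT _ _ vd)[Ty ya].
  have := strongly_monotone Tx Ty xa (da _ vd) ya (da _ vd).
  rewrite subrr dot0l pmulr_rle0// => h.
  apply/eqP; rewrite -subr_eq0; apply/eqP/enorm_eq0/eqP.
  by rewrite -sqrf_eq0 eq_le sqr_ge0 h.
exists delta, M0; split=> //; split.
  apply: (@uniq 0); [by rewrite enorm0|exact: hM0|].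
  apply/argminE; split=> //; first by rewrite subrr enorm0 ltW.
  move=> u Gu ug; rewrite !dot0l !subr0.
  apply: le_trans (strong_growth Gu (le_lt_trans ug ga)).
  by rewrite lerDl mulr_ge0 ?divr_ge0 ?sqr_ge0.
split=> [v vd x|v1 v2 v1d v2d].
  by split=> [/uniq|->]; [apply|exact: hM0].
have [T1 x1a] := argminT _ _ v1d (hM0 v1).
have [T2 x2a] := argminT _ _ v2d (hM0 v2).
have := strongly_monotone T1 T2 x1a (da _ v1d) x2a (da _ v2d).
move=> /le_trans/(_ (cauchy_schwarz _ _)); rewrite ler_pdivlMl//.
set A := enorm (M0 v1 - M0 v2); set B := enorm _ => h.
have [->|An] := eqVneq A 0; first by rewrite mulr0 enorm_ge0.
have A0 : 0 < A by rewrite lt_def An enorm_ge0.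
by rewrite -(ler_pM2r A0) -mulrA -expr2.
Qed.

End ConvexMinorant.

(** * Second-order Taylor bounds *)

Section Calculus.
Context {R : realType} {n : nat}.
Local Notation vec := 'rV[R]_n.
Implicit Types (h : vec -> R) (x y p d : vec).

Lemma is_derive_line h p d t : derivable h (p + t *: d) d ->
  is_derive t 1 (fun s : R => h (p + s *: d)) ('D_d h (p + t *: d)).
Proof.
move=> hd.
have E : (fun k : R => k^-1 *: (((fun s : R => h (p + s *: d)) \o shift t) (k *: 1)
             - h (p + t *: d))) =
    (fun k : R => k^-1 *: ((h \o shift (p + t *: d)) (k *: d) - h (p + t *: d))).
  apply/funext => k /=; congr (_ *: (h _ - _)).
  by rewrite [k *: 1]mulr1 scalerDl addrCA.
by apply: DeriveDef; rewrite ?/derivable ?/derive E.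
Qed.

Lemma mvt_from0 (g dg : R -> R) (c : R) :
  (forall t : R, `|t| <= `|c| -> is_derive t 1 g (dg t)) ->
  exists2 t, `|t| <= `|c| & g c - g 0 = dg t * c.
Proof.
move=> gd.
have [c0|/ltW c0] := leP 0 c.
- have Ic (t : R) : t \in `[0, c] -> `|t| <= `|c|.
    by rewrite in_itv/= => /andP[t0 tc]; rewrite !ger0_norm.
  have [||t tc E] := @MVT_segment R g dg _ _ c0.
  + by move=> t tc; apply/gd/Ic; exact: subset_itv_oo_cc tc.
  + apply: derivable_within_continuous => t tc.
    by have [] := gd t (Ic t tc).
  by exists t; [exact: Ic|rewrite E subr0].
- have Ic (t : R) : t \in `[c, 0] -> `|t| <= `|c|.
    by rewrite in_itv/= => /andP[t0 tc]; rewrite !ler0_norm// lerN2.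
  have [||t tc E] := @MVT_segment R g dg _ _ c0.
  + by move=> t tc; apply/gd/Ic; exact: subset_itv_oo_cc tc.
  + apply: derivable_within_continuous => t tc.
    by have [] := gd t (Ic t tc).
  by exists t; [exact: Ic|rewrite -opprB E sub0r mulrN opprK].
Qed.

Lemma enorm_le_coordwise (u w : vec) :
  (forall i, `|u 0 i| <= `|w 0 i|) -> enorm u <= enorm w.
Proof.
move=> uw; rewrite ler_sqrt; last exact: dot_ge0.
apply: ler_sum => i _; rewrite -!expr2 -(real_normK (num_real (u 0 i))).
by rewrite -(real_normK (num_real (w 0 i))) ler_pXn2r// nnegrE.
Qed.

Definition C1_on h (xb : vec) (r : R) := forall x, enorm (x - xb) < r ->
  forall i : 'I_n, derivable h x (unitv R i) /\
    {for x, continuous (fun z => 'D_(unitv R i) h z)}.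

(** Pass from [x] to [y] one coordinate at a time: each move is a one-variable mean value step for a
    partial derivative, compared with its value at [x] by continuity. *)
Lemma C1_frechet h xb r x (e : R) : C1_on h xb r -> enorm (x - xb) < r ->
  0 < e -> exists2 d, 0 < d & forall y, enorm (y - x) < d ->
    `|h y - h x - dot (grad h x) (y - x)| <= e * enorm (y - x).
Proof.
move=> hC xr e0; pose e' := e / n.+1%:R.
have e'0 : 0 < e' by rewrite divr_gt0.
have [d d0 hd] : exists2 d, 0 < d & forall z, enorm (z - x) < d -> forall i : 'I_n,
    `|'D_(unitv R i) h z - 'D_(unitv R i) h x| < e'.
  apply: forall_eball => i.
  exact: (continuous_enormP _ _).1 (hC x xr i).2 _ e'0.
exists (Num.min d (r - enorm (x - xb))); first by rewrite lt_min d0 subr_gt0.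
move=> y; rewrite lt_min => /andP[yd yr].
pose p (k : nat) : vec := \row_i (if (i < k)%N then y 0 i else x 0 i).
have p0 : p 0%N = x by apply/rowP => i; rewrite mxE ltn0.
have pn : p n = y by apply/rowP => i; rewrite mxE ltn_ord.
have pS (k : 'I_n) : p k.+1 = p k + (y 0 k - x 0 k) *: unitv R k.
  apply/rowP => i; rewrite !mxE eqxx/= ltnS leq_eqVlt.
  have [->|ik] := eqVneq i k; first by rewrite eqxx/= ltnn mulr1 addrC subrK.
  by rewrite (_ : (i == k :> nat) = false) ?mulr0 ?addr0//; exact/negbTE.
have close (k : 'I_n) t : `|t| <= `|y 0 k - x 0 k| ->
    enorm (p k + t *: unitv R k - x) <= enorm (y - x).
  move=> tk; apply: enorm_le_coordwise => i; rewrite !mxE eqxx/=.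
  have [->|ik] := eqVneq i k; first by rewrite ltnn mulr1 addrAC subrr add0r.
  rewrite mulr0 addr0; case: ifP => // _; by rewrite subrr normr0.
have step (k : 'I_n) : `|h (p k.+1) - h (p k) - (grad h x) 0 k * (y - x) 0 k|
    <= e' * enorm (y - x).
  have [|t tk E] := @mvt_from0 (fun t => h (p k + t *: unitv R k))
      (fun t => 'D_(unitv R k) h (p k + t *: unitv R k)) (y 0 k - x 0 k).
    move=> t tk; apply: is_derive_line; apply: (hC _ _ k).1.
    have := enorm_trans (p k + t *: unitv R k) x xb.
    by have := close k t tk; lra.
  rewrite scale0r addr0 -pS in E; rewrite E !mxE -mulrBl normrM.
  apply: ler_pM => //.
    by apply: ltW; apply: hd; apply: le_lt_trans yd; exact: close.
  by have := enorm_coord (y - x) k; rewrite !mxE.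
have -> : h y - h x - dot (grad h x) (y - x) =
    \sum_(k < n) (h (p k.+1) - h (p k) - (grad h x) 0 k * (y - x) 0 k).
  rewrite sumrB; congr (_ - _).
  by rewrite -(big_mkord xpredT (fun k => h (p k.+1) - h (p k))) telescope_sumr// pn p0.
apply: (le_trans (ler_norm_sum _ _ _)).
apply: (@le_trans _ _ (\sum_(k < n) e' * enorm (y - x))); first exact: ler_sum.
rewrite sumr_const card_ord -mulr_natl mulrA ler_wpM2r// /e' mulrCA.
by rewrite ler_piMr ?(ltW e0)// ler_pdivrMr// mul1r ler_nat.
Qed.

(** [C1_on] only speaks of coordinate directions; [C1_frechet] supplies the derivative along the
    segment, to which the one-variable mean value theorem applies. *)
Lemma C1_mvt h xb r x y : C1_on h xb r -> enorm (x - xb) < r ->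
  enorm (y - xb) < r -> exists2 z, enorm (z - xb) < r /\ enorm (z - x) <= enorm (y - x) &
    h y - h x = dot (grad h z) (y - x).
Proof.
move=> hC xr yr; pose d := y - x.
have ball (t : R) : 0 <= t <= 1 -> enorm (x + t *: d - xb) < r.
  move=> t01; have -> : x + t *: d = t *: y + (1 - t) *: x.
    by apply/rowP => i; rewrite !mxE; ring.
  exact: (convex_eball yr xr t01).
have der (t : R) : 0 <= t <= 1 -> is_derive t 1 (fun s : R => h (x + s *: d))
    (dot (grad h (x + t *: d)) d).
  move=> t01; set z := x + t *: d.
  have lim : (fun k : R => k^-1 *: (((fun s : R => h (x + s *: d)) \o shift t) (k *: 1)
      - h z)) @ 0^' --> dot (grad h z) d.
    apply/cvgrPdist_le => e e0.
    have D1 : 0 < enorm d + 1 by rewrite ltr_wpDl.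
    have [del del0 hdel] := C1_frechet hC (ball t t01) (divr_gt0 e0 D1).
    near=> k.
    have k0 : k != 0 by near: k; exact: nbhs_dnbhs_neq.
    have -> : ((fun s : R => h (x + s *: d)) \o shift t) (k *: 1) = h (z + k *: d).
      by rewrite /= [k *: 1]mulr1 scalerDl addrCA addrC.
    have zk : z + k *: d - z = k *: d by rewrite addrAC subrr add0r.
    have kd : enorm (z + k *: d - z) < del.
      rewrite zk enormZ.
      have : `|k| < del / (enorm d + 1).
        near: k; apply: dnbhs0_lt; exact: divr_gt0.
      rewrite ltr_pdivlMr//; apply: le_lt_trans.
      by rewrite ler_wpM2l// lerDl.
    have := hdel _ kd; rewrite -/z zk dotZr enormZ => H.
    change (`|dot (grad h z) d - k^-1 * (h (z + k *: d) - h z)| <= e).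
    rewrite -(ler_pM2l (_ : 0 < `|k|)) ?normr_gt0// -normrM mulrBr mulVKf// distrC.
    apply: (le_trans H); rewrite mulrCA ler_wpM2l// mulrAC ler_pdivrMr//.
    by rewrite ler_pM2l// lerDl.
  by apply: DeriveDef; [apply/cvg_ex; exists (dot (grad h z) d)|exact/cvg_lim].
have [||t tc E] := @MVT_segment R (fun s : R => h (x + s *: d))
    (fun t => dot (grad h (x + t *: d)) d) 0 1 ler01.
- move=> t tc; apply: der; move: tc; rewrite in_itv/= => /andP[t0 t1].
  by rewrite !ltW.
- apply: derivable_within_continuous => t; rewrite in_itv/= => tc.
  by have [] := der t tc.
rewrite in_itv/= in tc; exists (x + t *: d); last first.
  have xd : x + d = y by rewrite /d addrC subrK.
  by move: E; rewrite scale1r scale0r addr0 subr0 mulr1 xd.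
split; first exact: ball.
rewrite addrAC subrr add0r enormZ; case/andP: tc => t0 t1.
by rewrite ger0_norm// ler_piMl.
Unshelve. all: by end_near. Qed.

(** Collects what is used of [C^2] smoothness: the Taylor remainder and the Lipschitz bound of the
    gradient have a constant [C] uniform on the ball, while the expansion of the gradient by the
    Hessian is only pointwise. *)
Definition C2_bound h (xb : vec) (r C : R) := forall x, enorm (x - xb) < r ->
  [/\ forall i j : 'I_n, derivable h x (unitv R i) /\
        derivable (fun z => 'D_(unitv R i) h z) x (unitv R j),
      forall y, enorm (y - xb) < r ->
        `|h y - h x - dot (grad h x) (y - x)| <= C * enorm (y - x) ^+ 2,
      forall y, enorm (y - xb) < r ->
        enorm (grad h y - grad h x) <= C * enorm (y - x) &
      forall e, 0 < e -> exists2 d, 0 < d & forall y, enorm (y - x) < d ->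
        `|dot (grad h y - grad h x) (y - x) - quad (hess h x) (y - x)|
          <= e * enorm (y - x) ^+ 2].

Lemma C2_bound_mono h xb r r' C C' : r' <= r -> C <= C' ->
  C2_bound h xb r C -> C2_bound h xb r' C'.
Proof.
move=> rr CC hC x xr; have [h1 h2 h3 h4] := hC x (lt_le_trans xr rr).
split=> // y yr.
- by rewrite (le_trans (h2 y (lt_le_trans yr rr)))// ler_wpM2r// sqr_ge0.
- by rewrite (le_trans (h3 y (lt_le_trans yr rr)))// ler_wpM2r.
Qed.

(** Continuity at [xb] bounds the second partials nearby; the mean value theorem on the first
    partials makes the gradient Lipschitz, which gives the Taylor bound. The last clause is
    [C1_frechet] for each first partial. *)
Lemma C2_around_bound h xb : C2_around h xb ->
  exists r C, [/\ 0 < r, 0 <= C & C2_bound h xb r C].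
Proof.
move=> [r [r0 hr]].
have C1h : C1_on h xb r by move=> x xr i; have [? [_ [? _]]] := hr x xr i i.
have C1dh i : C1_on (fun z => 'D_(unitv R i) h z) xb r.
  by move=> x xr j; have [_ [? [_ ?]]] := hr x xr i j.
(* The sum over all index pairs exceeds every second partial at [xb] by at least 1, which leaves
   room for its variation nearby. *)
pose K : R := \sum_(ij : 'I_n * 'I_n)
  (`|'D_(unitv R ij.2) (fun z => 'D_(unitv R ij.1) h z) xb| + 1).
have K0 : 0 <= K by apply: sumr_ge0 => ij _; rewrite addr_ge0.
have [d d0 hd] : exists2 d, 0 < d & forall z, enorm (z - xb) < d ->
    forall ij : 'I_n * 'I_n,
      `|'D_(unitv R ij.2) (fun z => 'D_(unitv R ij.1) h z) z| <= K.
  apply: forall_eball => -[i j].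
  have xbr : enorm (xb - xb) < r by rewrite subrr enorm0.
  have [d d0 hd] := (continuous_enormP _ _).1 (C1dh i xb xbr j).2 _ ltr01.
  exists d => // y /hd /= yd; rewrite /K (bigD1 (i, j))//=.
  apply: ler_wpDr; first by apply: sumr_ge0 => ij _; rewrite addr_ge0.
  move: ('D_(unitv R j) _ y) ('D_(unitv R j) _ xb) yd => a b.
  by have := ler_normD (a - b) b; rewrite subrK; lra.
pose r' := Num.min r d.
have r'0 : 0 < r' by rewrite lt_min r0.
have r'r : r' <= r by rewrite ge_min lexx.
have r'd : r' <= d by rewrite ge_min lexx orbT.
pose C : R := n%:R * (n%:R * K).
have C0 : 0 <= C by rewrite !mulr_ge0.
have C1r' g : C1_on g xb r -> C1_on g xb r'.
  by move=> gC x xr; apply: gC; exact: lt_le_trans r'r.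
have lipD x y : enorm (x - xb) < r' -> enorm (y - xb) < r' ->
    enorm (grad h y - grad h x) <= C * enorm (y - x).
  move=> xr yr; rewrite /C -mulrA; apply: enorm_le_coords => [|i].
    by rewrite !mulr_ge0.
  have [z [zr _]] := C1_mvt (C1r' _ (C1dh i)) xr yr.
  rewrite !mxE => ->; apply: (le_trans (dot_abs_le _ _)); rewrite ler_wpM2r//.
  apply: enorm_le_coords => // j; rewrite mxE.
  exact: (hd z (lt_le_trans zr r'd) (i, j)).
exists r', C; split=> // x xr; have xr' := lt_le_trans xr r'r; split.
- by move=> i j; have [? [? _]] := hr x xr' i j.
- move=> y yr; have [z [zr zx] E] := C1_mvt (C1r' _ C1h) xr yr.
  rewrite E -dotNl -dotDl (le_trans (dot_abs_le _ _))// expr2 mulrA ler_wpM2r//.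
  by rewrite (le_trans (lipD x z xr zr))// ler_wpM2l.
- by move=> y yr; exact: lipD.
move=> e e0; pose e' := e / n.+1%:R.
have e'0 : 0 < e' by rewrite divr_gt0.
have [d' d'0 hd'] : exists2 d, 0 < d & forall y, enorm (y - x) < d ->
    forall i : 'I_n, `|'D_(unitv R i) h y - 'D_(unitv R i) h x
      - dot (grad (fun z => 'D_(unitv R i) h z) x) (y - x)| <= e' * enorm (y - x).
  by apply: forall_eball => i; exact: C1_frechet (C1dh i) xr' e'0.
exists d' => // y /hd' yd'.
have -> : quad (hess h x) (y - x) =
    \sum_(i < n) dot (grad (fun z => 'D_(unitv R i) h z) x) (y - x) * (y - x) 0 i.
  apply: eq_bigr => i _; congr (_ * _); rewrite mxE.
  by apply: eq_bigr => j _; rewrite !mxE mulrC.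
rewrite /dot -sumrB; apply: (le_trans (ler_norm_sum _ _ _)).
apply: (@le_trans _ _ (\sum_(k < n) e' * enorm (y - x) ^+ 2)).
  apply: ler_sum => i _; rewrite -mulrBl normrM expr2 mulrA.
  apply: ler_pM => //; last exact: enorm_coord.
  by rewrite !mxE; exact: yd'.
rewrite sumr_const card_ord -mulr_natl mulrA ler_wpM2r ?sqr_ge0// /e' mulrCA.
by rewrite ler_piMr ?(ltW e0)// ler_pdivrMr// mul1r ler_nat.
Qed.

End Calculus.

(** * Multipliers *)

Section LinearCombinations.
Context {R : realType} {n m : nat}.
Local Notation vec := 'rV[R]_n.

Lemma derive_lincomb (h : 'I_m -> vec -> R) (y : 'I_m -> R) (x v : vec) :
  (forall i, derivable (h i) x v) ->
  'D_v (fun z => \sum_(i < m) y i * h i z) x = \sum_(i < m) y i * 'D_v (h i) x.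
Proof.
move=> hd; rewrite (_ : (fun z => _) = \sum_(i < m) (y i \*: h i)).
  rewrite derive_sum => [|i]; last exact: derivableZ.
  by apply: eq_bigr => i _; rewrite deriveZ.
by apply/funext => z; rewrite fct_sumE.
Qed.

Lemma quadE (A : 'M[R]_n) (w : vec) :
  quad A w = \sum_(i < n) \sum_(j < n) A i j * w 0 j * w 0 i.
Proof.
apply: eq_bigr => i _; rewrite mxE big_distrl; apply: eq_bigr => j _ /=.
by rewrite mxE (mulrC (w 0 j)).
Qed.

Lemma quadZ (A : 'M[R]_n) t (w : vec) : quad A (t *: w) = t ^+ 2 * quad A w.
Proof.
rewrite !quadE big_distrr; apply: eq_bigr => i _ /=.
by rewrite big_distrr; apply: eq_bigr => j _ /=; rewrite !mxE; ring.
Qed.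

Lemma cvg_quad {T : Type} {F : set_system T} {FF : Filter F}
    (A : 'M[R]_n) (u : T -> vec) w :
  u @ F --> w -> (fun k => quad A (u k)) @ F --> quad A w.
Proof.
move=> uw.
rewrite [X in X @ _](_ : _ = fun k =>
  \sum_(i < n) \sum_(j < n) A i j * u k 0 j * u k 0 i); last first.
  by apply/funext => k; rewrite quadE.
rewrite quadE; apply: cvg_big => [|i _]; first exact: add_continuous.
apply: cvg_big => [|j _]; first exact: add_continuous.
have uc l : (fun k => u k 0 l) @ F --> w 0 l.
  exact: (cvg_comp _ _ uw (@continuous_coord _ _ l w)).
by apply: cvgM => //; apply: cvgM => //; exact: cvg_cst.
Qed.

Lemma sec_order_ygx (f : vec -> R) (phi : 'I_m -> vec -> R) (xb x w : vec) y
    (r C : R) : (forall i, C2_bound (phi i) xb r C) -> enorm (x - xb) < r ->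
  sec_order f phi x y w =
  quad (hess f x) w + \sum_(i < m) y 0 i * quad (hess (phi i) x) w.
Proof.
move=> hC xr; rewrite /sec_order dotC; congr (_ + _).
rewrite -[LHS]/(quad (hess (ygx phi y) x) w) quadE.
have hessE (i j : 'I_n) : hess (ygx phi y) x i j =
    \sum_(k < m) y 0 k * hess (phi k) x i j.
  rewrite mxE; under [RHS]eq_bigr do rewrite mxE.
  rewrite -derive_lincomb; last by move=> k; have [/(_ i j)[]] := hC k x xr.
  (* The formula for the first partials must hold on a neighbourhood of [x] before it can be
     differentiated again. *)
  apply: near_eq_derive; apply/nbhs_enormP; exists (r - enorm (x - xb)).
    by rewrite subr_gt0.
  move=> z zx; apply: derive_lincomb => k.
  have zr : enorm (z - xb) < r by have := enorm_trans z x xb; lra.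
  by have [/(_ i j)[]] := hC k z zr.
under [RHS]eq_bigr => k _ do rewrite quadE big_distrr /=.
rewrite [RHS]exchange_big; apply: eq_bigr => i _ /=.
under [RHS]eq_bigr => k _ do rewrite big_distrr /=.
rewrite [RHS]exchange_big; apply: eq_bigr => j _ /=.
rewrite hessE 2!big_distrl /=.
by apply: eq_bigr => k _; rewrite !mulrA.
Qed.

(* Finite-dimensional bipolar theorem for a zonotope: a vector majorised by the
   support function of [{\sum_i y_i g_i | lo <= y <= hi}] belongs to that set. *)
Lemma zonotope_mem (g : 'I_m -> vec) (lo hi : 'I_m -> R) (b : vec) :
  (forall i, lo i <= hi i) ->
  (forall w, dot b w <=
     \sum_(i < m) Num.max (lo i * dot (g i) w) (hi i * dot (g i) w)) ->
  exists2 y : 'rV[R]_m, (forall i, lo i <= y 0 i <= hi i) &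
    b = \sum_(i < m) y 0 i *: g i.
Proof.
move=> lohi hb; pose A (y : 'rV[R]_m) : vec := \sum_(i < m) y 0 i *: g i.
have AB y z : A y - A z = \sum_(i < m) (y - z) 0 i *: g i.
  by rewrite -sumrB; apply: eq_bigr => i _; rewrite -scalerBl !mxE.
have AZ t y : t *: A y = A (t *: y).
  by rewrite scaler_sumr; apply: eq_bigr => i _; rewrite scalerA mxE.
have AD y z : A (y + z) = A y + A z.
  by rewrite -big_split; apply: eq_bigr => i _; rewrite mxE scalerDl.
pose S := [set y : 'rV[R]_m | forall i, lo i <= y 0 i <= hi i].
pose K := \sum_(i < m) (`|lo i| + `|hi i|).
have KS i : `|lo i| + `|hi i| <= K.
  rewrite /K (bigD1 i)//= lerDl; apply: sumr_ge0 => j _; exact: addr_ge0.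
have K0 : 0 <= K by apply: sumr_ge0 => i _; exact: addr_ge0.
pose N := \sum_(i < m) enorm (g i).
have N0 : 0 <= N by apply: sumr_ge0.
(* [y] gives the point of the zonotope nearest to [b]; the rest shows that the distance is zero. *)
have [||||y Sy ymin] := @min_exists R m S (fun y => enorm (b - A y)) (m%:R * K).
- by exists (\row_i lo i) => i; rewrite mxE lexx lohi.
- move=> y Sy; apply: enorm_le_coords => // i; apply: le_trans (KS i).
  have /andP[] := Sy i; have := ler_norm (hi i); have := ler_norm (- lo i).
  rewrite normrN ler_norml; have := normr_ge0 (lo i); have := normr_ge0 (hi i).
  by move=> *; apply/andP; split; lra.
- apply: closed_enormP => y hy i.
  have hi' e : 0 < e -> lo i - e <= y 0 i <= hi i + e.
    move=> /hy[z Sz zy]; have /andP[] := Sz i.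
    have := le_lt_trans (enorm_coord (z - y) i) zy.
    by rewrite !mxE ltr_norml => /andP[? ?] *; apply/andP; split; lra.
  apply/andP; split; apply/ler_addgt0Pr => e /hi'/andP[]; lra.
- move=> y _; apply/continuous_enormP => e e0.
  have N1 : 0 < N + 1 by rewrite ltr_wpDl.
  exists (e / (N + 1)); first by rewrite divr_gt0.
  move=> z; rewrite ltr_pdivlMr// mulrC; apply: le_lt_trans.
  rewrite -[enorm (b - A z)]enormN -[enorm (b - A y)]enormN !opprB.
  apply: (le_trans (enorm_lipschitz _ _ _)); rewrite AB.
  apply: (@le_trans _ _ (N * enorm (z - y))); last by rewrite ler_wpM2r// lerDl.
  have H : forall (s : seq 'I_m), enorm (\sum_(i <- s) (z - y) 0 i *: g i) <=
      \sum_(i <- s) enorm (g i) * enorm (z - y).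
    elim=> [|i s IH]; first by rewrite !big_nil enorm0.
    rewrite !big_cons (le_trans (enormD _ _))// lerD// enormZ mulrC ler_wpM2l//.
    exact: enorm_coord.
  by rewrite /N big_distrl; exact: H.
exists y => //; apply/eqP; rewrite -subr_eq0; apply/eqP.
set w := b - A y.
(* The variational inequality of the projection, from moving a small step towards [z] inside the
   box. *)
have opt z : S z -> dot w (A z - A y) <= 0.
  move=> Sz; set c := A z - A y; apply/ler_addgt0Pr => e e0; rewrite add0r.
  have cc : 0 < dot c c + 1 by rewrite ltr_wpDl// dot_ge0.
  pose t := Num.min 1 (e / (dot c c + 1)).
  have t0 : 0 < t by rewrite lt_min ltr01 divr_gt0.
  have t1 : t <= 1 by rewrite ge_min lexx.
  have te : t * (dot c c + 1) <= e by rewrite -ler_pdivlMr// ge_min lexx orbT.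
  have := ymin (y + t *: (z - y)) _.
  have -> : b - A (y + t *: (z - y)) = w - t *: c.
    have AN : A (z - y) = c by rewrite /c AB.
    by rewrite AD -AZ AN opprD addrA.
  rewrite -/w => h.
  have {h} h : enorm w <= enorm (w - t *: c).
    apply: h => i; rewrite !mxE; have /andP[y1 y2] := Sy i; have /andP[z1 z2] := Sz i.
    by apply/andP; split; nra.
  have : enorm w ^+ 2 <= enorm (w - t *: c) ^+ 2 by rewrite ler_pXn2r ?nnegrE.
  rewrite (enormB_sqr w) dotZr enormZ exprMn real_normK ?num_real// (enorm_sqr c) => h'.
  have h2 : t * (2 * dot w c) <= t * (t * dot c c) by lra.
  rewrite ler_pM2l// in h2.
  have := mulr_ge0 (ltW t0) (dot_ge0 c); have := e0; lra.
(* The vertex of the box at which the support function in direction [w] is attained. *)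
pose z : 'rV[R]_m := \row_i (if 0 <= dot (g i) w then hi i else lo i).
have Sz : S z by move=> i; rewrite mxE; case: ifP; rewrite ?lexx ?lohi.
have Az : dot (A z) w =
    \sum_(i < m) Num.max (lo i * dot (g i) w) (hi i * dot (g i) w).
  rewrite dot_suml; apply: eq_bigr => i _; rewrite dotZl mxE.
  have := lohi i; case: ifPn => [d0 lh|]; first by rewrite max_r// ler_wpM2r.
  by rewrite -ltNge => d0 lh; rewrite max_l// ler_wnM2r// ltW.
apply/enorm_eq0/eqP; rewrite -sqrf_eq0 eq_le sqr_ge0 andbT enorm_sqr.
have := opt z Sz; have := hb w; rewrite -Az.
rewrite dotDr dotNr (dotC (A z)).
have -> : dot w w = dot b w - dot w (A y).
  by rewrite {1}/w dotDl dotNl (dotC (A y)).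
lra.
Qed.

End LinearCombinations.

(** * Normal vectors, bounded multipliers and prox-regularity under MSCQ *)

Section NonlinearProgram.
Context {R : realType} {n m : nat}.
Local Notation vec := 'rV[R]_n.
Variables (s : nat) (f : vec -> R) (phi : 'I_m -> vec -> R) (xb : vec).
Variables (rho C kap : R).
Hypotheses (rho0 : 0 < rho) (C0 : 0 <= C) (kap0 : 0 < kap).
Hypothesis fC : C2_bound f xb rho C.
Hypothesis phiC : forall i, C2_bound (phi i) xb rho C.
Local Notation G := (feasible s phi).
Local Notation T := (rsubdiff (constrained f G)).

(** Merges the two sums of MSCQ into a single one over all constraints. *)
Let viol (i : 'I_m) (c : R) : R := if (i < s)%N then Num.max c 0 else `|c|.

Hypothesis mscq : forall x, enorm (x - xb) < rho ->
  Defs.dist x G <= kap * \sum_(i < m) viol i (phi i x).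

(* Violation rate at [x] of the [i]-th linearised constraint in direction [w]. *)
Let lin_viol (x w : vec) (i : 'I_m) : R :=
  if (i < s)%N && (phi i x < 0) then 0 else viol i (dot (grad (phi i) x) w).

Lemma dist_adherent x u e : G x -> 0 < e ->
  exists2 p, G p & enorm (u - p) < Defs.dist u G + e.
Proof.
move=> Gx e0; have hE : has_inf [set enorm (u - z) | z in G].
  by split; [exists (enorm (u - x)), x|exists 0 => _ [z _ <-]].
by have [_ [p Gp <-] h] := inf_adherent e0 hE; exists p.
Qed.

Lemma dist_le x u : G x -> Defs.dist u G <= enorm (u - x).
Proof.
by move=> Gx; apply: ge_inf; [exists 0 => _ [z _ <-]|exists x].
Qed.

(** First-order Taylor expansion with remainder at most [t * e]; the last hypothesis makes [t] so
    small that inactive inequalities stay satisfied. *)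
Lemma viol_step i x w t e : G x -> enorm (x - xb) < rho ->
  enorm (x + t *: w - xb) < rho -> 0 < t -> 0 <= e ->
  t * (C * enorm w ^+ 2) <= e ->
  (phi i x < 0 -> t * (`|dot (grad (phi i) x) w| + e) <= - phi i x) ->
  viol i (phi i (x + t *: w)) <= t * (lin_viol x w i + e).
Proof.
move=> Gx xr ur t0 e0 tC ti.
have [_ /(_ _ ur) h _ _] := phiC i xr.
have xw : x + t *: w - x = t *: w by rewrite addrAC subrr add0r.
move: h; rewrite xw dotZr enormZ (gtr0_norm t0) exprMn => h.
have {h} : `|phi i (x + t *: w) - phi i x - t * dot (grad (phi i) x) w| <= t * e.
  apply: (le_trans h).
  by rewrite expr2 mulrCA -mulrA ler_pM2l// mulrC -mulrA [_ * t]mulrC.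
rewrite /lin_viol /viol; set d := dot _ w in ti *.
have [Gi Ge] := Gx i; have d1 := ler_norm d; have d2 := ler_norm (- d).
rewrite normrN in d2.
case: ifPn => [is_|] /=; rewrite ?andbT ?andbF /=.
  have Gi' := Gi is_; case: ifPn => [neg|pos]; rewrite ler_norml => /andP[_ h].
    have := ti neg; rewrite ge_max => h'.
    by rewrite add0r mulr_ge0 ?(ltW t0)// andbT; nra.
  rewrite -leNgt in pos; rewrite ge_max.
  have p0 : phi i x = 0 by apply/eqP; rewrite eq_le Gi'.
  have m1 : d <= Num.max d 0 by rewrite le_max lexx.
  have m2 : 0 <= Num.max d 0 by rewrite le_max lexx orbT.
  by apply/andP; split; nra.
rewrite -leqNgt => /Ge ->; rewrite subr0 => h.
rewrite -[phi i _](subrK (t * d)) (le_trans (ler_normD _ _))//.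
by rewrite normrM gtr0_norm//; lra.
Qed.

(** Move from [x] to [u = x + t w] and return to a nearly closest feasible [p]. MSCQ bounds
    [|u - p|] by the linearised violation, the subgradient inequality at [p] bounds the rest to
    first order, and dividing by [t] leaves the claim. *)
Lemma normal_support x v w : T x v -> enorm (x - xb) < rho ->
  dot (v - grad f x) w <=
  kap * enorm (v - grad f x) * \sum_(i < m) lin_viol x w i.
Proof.
move=> Tx xr; set xs := v - grad f x; set N := enorm xs; set D := enorm w.
set S := \sum_(i < m) _.
have N0 : 0 <= N by exact: enorm_ge0.
have D0 : 0 <= D by exact: enorm_ge0.
pose M := 2 * (2 * D + 1) + N * (kap * m%:R + 1).
have M0 : 0 <= M by rewrite /M !(addr_ge0, mulr_ge0)// ltW.
(* [M] collects the coefficients of all error terms linear in [e]. *)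
suff key e : 0 < e -> e <= 1 -> dot xs w <= kap * N * S + e * M.
  apply/ler_addgt0Pr => e e0.
  have M1 : 0 < M + 1 by rewrite ltr_wpDl.
  have e1 : 0 < Num.min 1 (e / (M + 1)) by rewrite lt_min ltr01 divr_gt0.
  apply: (le_trans (key _ e1 _)); first by rewrite ge_min lexx.
  have : Num.min 1 (e / (M + 1)) * (M + 1) <= e.
    by rewrite -ler_pdivlMr// ge_min lexx orbT.
  by move: e1; set q := Num.min _ _; nra.
move=> e0 e1; have /rsubdiff_constrained[Gx /(_ e e0)[del del0 hdel]] := Tx.
pose a i := `|dot (grad (phi i) x) w| + 1.
have a0 i : 0 <= a i by rewrite addr_ge0.
(* With [t = B / A], every summand of [A] times [t] is at most [B], so one choice of [t] meets all
   smallness conditions; [B0] is the least slack of the constraints negative at [x], capped by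
   [e]. *)
pose A := 2 * (2 * D + 1) + C * (2 * D + 1) + C * D ^+ 2 + \sum_(i < m) a i.
pose B0 := \big[Num.min/e]_(i < m | phi i x < 0) - phi i x.
pose B := Num.min (Num.min del (rho - enorm (x - xb))) B0.
have sa0 : 0 <= \sum_(i < m) a i by exact: sumr_ge0.
have CD0 : 0 <= C * (2 * D + 1) by rewrite mulr_ge0// addr_ge0// mulr_ge0.
have CD2 : 0 <= C * D ^+ 2 by rewrite mulr_ge0// sqr_ge0.
have A0 : 0 < A by rewrite /A; lra.
have B00 : 0 < B0.
  apply: lt_bigmin => // i; rewrite oppr_gt0//.
have Bpos : 0 < B by rewrite !lt_min del0 subr_gt0 xr B00.
pose t := B / A; have t0 : 0 < t by rewrite divr_gt0.
have tA : t * A = B by rewrite /t divfK// gt_eqF.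
have tle c : c <= A -> t * c <= B by move=> cA; rewrite -tA ler_wpM2l// ltW.
have Bdel : B <= del by rewrite !ge_min lexx.
have Brho : B <= rho - enorm (x - xb) by rewrite !ge_min lexx orbT.
have BB0 : B <= B0 by rewrite ge_min lexx orbT.
have Be : B <= e by apply: (le_trans BB0); exact: bigmin_le_id.
have tD : t * (2 * (2 * D + 1)) <= B by apply: tle; rewrite /A; lra.
have tCD : t * (C * (2 * D + 1)) <= e.
  by apply: le_trans Be; apply: tle; rewrite /A; lra.
have tCD2 : t * (C * D ^+ 2) <= e.
  by apply: le_trans Be; apply: tle; rewrite /A; lra.
have ta i : phi i x < 0 -> t * (`|dot (grad (phi i) x) w| + e) <= - phi i x.
  move=> neg; apply: (@le_trans _ _ (t * a i)).
    by rewrite ler_pM2l// lerD2l.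
  apply: (@le_trans _ _ B0); last exact: (bigmin_le_cond _ (fun i => - phi i x)).
  apply: le_trans BB0; apply: tle.
  have : a i <= \sum_(i < m) a i.
    by rewrite (bigD1 i)//= lerDl; apply: sumr_ge0.
  by rewrite /A; lra.
have tD0 : 0 <= t * D by rewrite mulr_ge0// ltW.
set u := x + t *: w.
have ux : u - x = t *: w by rewrite /u addrAC subrr add0r.
have uxD : enorm (u - x) = t * D by rewrite ux enormZ gtr0_norm.
have ur : enorm (u - xb) < rho.
  by have := enorm_trans u x xb; rewrite uxD; lra.
have te0 : 0 < e * t by rewrite mulr_gt0.
have et : e * t <= t by rewrite ler_piMl// ltW.
(* The projection error [e * t] is negligible against [t] as [e] shrinks. *)
have [p Gp up] := @dist_adherent x u _ Gx te0.
have px : enorm (p - x) <= t * (2 * D + 1).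
  have := enorm_trans p u x; rewrite uxD (enormC p u).
  by have := dist_le u Gx; rewrite uxD; lra.
have pr : enorm (p - xb) < rho.
  by have := enorm_trans p x xb; lra.
have h1 : f x + dot v (p - x) - e * enorm (p - x) <= f p by apply: hdel => //; lra.
have [_ /(_ p pr) h2 _ _] := fC xr.
have Cp : C * enorm (p - x) ^+ 2 <= e * enorm (p - x).
  rewrite expr2 mulrA ler_wpM2r//.
  by apply: le_trans tCD; rewrite mulrCA ler_wpM2l.
have h3 : dot xs (p - x) <= 2 * e * (t * (2 * D + 1)).
  apply: (@le_trans _ _ (2 * e * enorm (p - x))); last first.
    by rewrite ler_wpM2l// mulr_ge0// ltW.
  by rewrite /xs (dotDl v) dotNl; move: h2; rewrite ler_norml => /andP[_]; lra.
have h4 : t * dot xs w = dot xs (p - x) + dot xs (u - p).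
  by rewrite -dotZr -ux -dotDr [X in _ = dot _ X]addrC subrKA.
have h5 : dot xs (u - p) <= N * (Defs.dist u G + e * t).
  by rewrite (le_trans (cauchy_schwarz _ _))// ler_wpM2l// ltW.
have h6 : \sum_(i < m) viol i (phi i u) <= t * (S + m%:R * e).
  rewrite mulrDr mulr_sumr.
  have -> : t * (m%:R * e) = \sum_(i < m) t * e.
    by rewrite sumr_const card_ord -(mulr_natl (t * e)) mulrCA.
  rewrite -big_split; apply: ler_sum => i _ /=; rewrite -mulrDr.
  by apply: viol_step => //; [exact: ltW|exact: ta].
have h7 : Defs.dist u G <= kap * (t * (S + m%:R * e)).
  by rewrite (le_trans (mscq ur))// ler_wpM2l// ltW.
have h8 : N * Defs.dist u G <= N * (kap * (t * (S + m%:R * e))).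
  by rewrite ler_wpM2l.
rewrite -(ler_pM2l t0) h4 /M; lra.
Qed.

(** The bound of [normal_support] is the support function of a zonotope, so [zonotope_mem]
    represents [v - grad f x] by gradients of constraints with coefficients in the matching box. *)
Lemma multiplier_exists x v : T x v -> enorm (x - xb) < rho ->
  exists y : 'rV[R]_m, [/\ multiplier s y, forall i, y 0 i * phi i x = 0,
    v = gradL f phi x y &
    forall i, `|y 0 i| <= kap * enorm (v - grad f x)].
Proof.
move=> Tx xr; have /rsubdiff_constrained[Gx _] := Tx.
set K := kap * _; have K0 : 0 <= K by rewrite mulr_ge0// ltW.
(* Coefficients range over [[0, K]] for active inequalities, [{0}] for inactive ones, which is
   complementarity, and [[-K, K]] for equalities. *)
pose hi (i : 'I_m) := if (i < s)%N && (phi i x < 0) then 0 else K.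
pose lo (i : 'I_m) := if (i < s)%N then 0 else - K.
have [|w|y ylh vE] := @zonotope_mem R n m (fun i => grad (phi i) x) lo hi
    (v - grad f x).
- by move=> i; rewrite /lo /hi; case: ltnP => //= _; [case: ifP|lra].
- apply: (le_trans (normal_support w Tx xr)); rewrite -/K big_distrr.
  apply: ler_sum => i _ /=; rewrite /lin_viol /viol /lo /hi.
  set d := dot _ w; case: ltnP => //= _; last first.
    by case: (lerP 0 d) => d0; rewrite ?(ger0_norm d0) ?(ltr0_norm d0) le_max;
      apply/orP; [right|left]; lra.
  case: ifP => _; first by rewrite mulr0 !mul0r maxxx.
  by rewrite mul0r maxC maxr_pMr// mulr0.
exists y; split.
- by move=> i is_; have := ylh i; rewrite /lo is_ => /andP[].
- move=> i; have := ylh i; have [Gi Ge] := Gx i; rewrite /lo /hi.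
  case: ltnP => //= is_; last by rewrite Ge ?mulr0.
  case: ltP => [_|pos _]; first by rewrite -eq_le => /eqP <-; rewrite mul0r.
  have -> : phi i x = 0 by apply/eqP; rewrite eq_le Gi.
  by rewrite mulr0.
- by rewrite /gradL -vE addrC subrK.
- move=> i; have := ylh i; rewrite /lo /hi ler_norml.
  by case: ltnP => //= _; case: ifP => _ /andP[? ?]; apply/andP; split; lra.
Qed.

(** [B] bounds [|grad f|] on the ball of radius [rho], so [K] bounds multipliers uniformly for
    [|v| < rho]. *)
Let B := enorm (grad f xb) + C * rho.
Let K := kap * (rho + B).

Lemma multiplier_bounded x v : T x v -> enorm (x - xb) < rho -> enorm v < rho ->
  exists y : 'rV[R]_m, [/\ multiplier s y, forall i, y 0 i * phi i x = 0,
    v = gradL f phi x y & forall i, `|y 0 i| <= K].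
Proof.
move=> Tx xr vr; have [y [ypos yphi vE yb]] := multiplier_exists Tx xr.
exists y; split=> // i; apply: (le_trans (yb i)); rewrite ler_pM2l//.
have xbr : enorm (xb - xb) < rho by rewrite subrr enorm0.
have [_ _ /(_ x xr) h _] := fC xbr.
have h' : C * enorm (x - xb) <= C * rho by rewrite ler_wpM2l// ltW.
rewrite (le_trans (enormB _ _))// lerD ?(ltW vr)// /B.
by have := enormD (grad f x - grad f xb) (grad f xb); rewrite subrK; lra.
Qed.

Lemma multiplier_bound_ge0 : 0 <= K.
Proof.
by rewrite /K mulr_ge0 ?(ltW kap0)// !addr_ge0 ?mulr_ge0 ?(ltW rho0).
Qed.

Lemma multiplier_feasible y u i : multiplier s y -> G u -> y 0 i * phi i u <= 0.
Proof.
move=> ypos Gu; have [Gi Ge] := Gu i; case: (ltnP i s) => is_.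
  by rewrite mulr_ge0_le0 ?ypos// Gi.
by rewrite Ge ?mulr0.
Qed.

(** At a feasible [u] the Lagrangian is at most [f u], and at [x] it equals [f x]; Taylor bounds for
    [f] and the [m] constraints give the quadratic constant. *)
Lemma lagrangian_minorant x u y k : 0 <= k -> enorm (x - xb) < rho -> G u ->
  enorm (u - xb) < rho -> multiplier s y -> (forall i, y 0 i * phi i x = 0) ->
  (forall i, `|y 0 i| <= k) ->
  f x + dot (gradL f phi x y) (u - x)
    - (C + m%:R * (k * C)) * enorm (u - x) ^+ 2 <= f u.
Proof.
move=> k0 xr Gu ur ypos yphi yb.
have [_ /(_ u ur) hf _ _] := fC xr.
set E := enorm (u - x) ^+ 2 in hf *; have E0 : 0 <= E by exact: sqr_ge0.
have hi (i : 'I_m) : y 0 i * dot (grad (phi i) x) (u - x) <= k * C * E.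
  have [_ /(_ u ur) h _ _] := phiC i xr.
  have := multiplier_feasible i ypos Gu.
  have h' : `|y 0 i * (phi i u - phi i x - dot (grad (phi i) x) (u - x))| <= k * (C * E).
    by rewrite normrM ler_pM.
  move: h'; rewrite ler_norml !mulrBr yphi => /andP[]; lra.
have : \sum_(i < m) y 0 i * dot (grad (phi i) x) (u - x) <= m%:R * (k * C) * E.
  apply: (@le_trans _ _ (\sum_(i < m) k * C * E)); first exact: ler_sum.
  by rewrite sumr_const card_ord -(mulr_natl (k * C * E)) !mulrA.
rewrite /gradL dotDl dot_suml; under [X in _ + (_ + X)]eq_bigr do rewrite dotZl.
by move: hf; rewrite ler_norml => /andP[]; lra.
Qed.

Lemma prox_regular x v u : T x v -> enorm (x - xb) < rho ->
  enorm v < rho -> G u -> enorm (u - xb) < rho ->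
  f x + dot v (u - x) - (C + m%:R * (K * C)) * enorm (u - x) ^+ 2 <= f u.
Proof.
move=> Tx xr vr Gu ur.
have [y [ypos yphi -> yb]] := multiplier_bounded Tx xr vr.
exact: lagrangian_minorant multiplier_bound_ge0 _ _ _ _ _ _.
Qed.

Lemma stationary_rsubdiff y : G xb -> multiplier s y -> gradL f phi xb y = 0 ->
  ygx phi y xb = 0 -> T xb 0.
Proof.
move=> Gxb ypos y0 yg; pose k := \sum_(i < m) `|y 0 i|.
(* All terms are nonpositive and their sum is zero. *)
have yphi i : y 0 i * phi i xb = 0.
  apply/eqP; rewrite -oppr_eq0; apply/eqP.
  apply: (@psumr_eq0P _ _ predT (fun i => - (y 0 i * phi i xb))) => //.
    by move=> j _; rewrite oppr_ge0 multiplier_feasible.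
  by rewrite sumrN -/(ygx phi y xb) yg oppr0.
have xbr : enorm (xb - xb) < rho by rewrite subrr enorm0.
apply: (@rsubdiff_of_quadratic _ _ _ _ xb _ _ (rho / 2) (C + m%:R * (k * C))) => //.
  by rewrite subrr enorm0 divr_gt0.
move=> u Gu ug; rewrite -y0; apply: lagrangian_minorant => //.
- exact: sumr_ge0.
- by apply: (le_lt_trans ug); move: rho0; lra.
- by move=> i; rewrite /k (bigD1 i)//= lerDl sumr_ge0.
Qed.

End NonlinearProgram.

(** * Monotonicity from the second-order condition *)

Section SecondOrder.
Context {R : realType} {n m : nat}.
Local Notation vec := 'rV[R]_n.
Variables (s : nat) (f : vec -> R) (phi : 'I_m -> vec -> R) (xb : vec).
Variables (rho C K sig : R).
Hypotheses (C0 : 0 <= C) (K0 : 0 <= K).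
Hypothesis fC : C2_bound f xb rho C.
Hypothesis phiC : forall i, C2_bound (phi i) xb rho C.
Local Notation G := (feasible s phi).
Local Notation T := (rsubdiff (constrained f G)).
Hypothesis multipliers : forall x v, T x v -> enorm (x - xb) < rho ->
  enorm v < rho -> exists y : 'rV[R]_m, [/\ multiplier s y,
    forall i, y 0 i * phi i x = 0, v = gradL f phi x y &
    forall i, `|y 0 i| <= K].
Hypothesis second_order : forall x v y, enorm (x - xb) < rho -> enorm v < rho ->
  multiplier s y -> v = gradL f phi x y -> ygx phi y x = 0 ->
  forall w, Scone s phi x y w -> sig * enorm w ^+ 2 <= sec_order f phi x y w.

Lemma C2_bound_continuous h x : C2_bound h xb rho C -> enorm (x - xb) < rho ->
  {for x, continuous h}.
Proof.
move=> hC xr; have [_ h2 _ _] := hC x xr.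
apply/continuous_enormP => e e0.
pose M := enorm (grad h x) + C * rho.
have rho0 : 0 < rho by apply: le_lt_trans xr.
have M0 : 0 <= M by rewrite addr_ge0// mulr_ge0// ltW.
have M1 : 0 < M + 1 by rewrite ltr_wpDl.
exists (Num.min (rho - enorm (x - xb)) (e / (M + 1))).
  by rewrite lt_min subr_gt0 xr divr_gt0.
move=> y; rewrite lt_min ltr_pdivlMr// => /andP[yx1 yx2].
have yr : enorm (y - xb) < rho by have := enorm_trans y x xb; lra.
apply: le_lt_trans yx2.
have := dot_abs_le (grad h x) (y - x); have := h2 y yr.
move: yx1; have := enorm_ge0 (y - x); have := enorm_ge0 (x - xb).
move: (dot _ _) (h y) (h x) => d a b; rewrite /M.
move: (enorm (y - x)) (enorm (grad h x)) (enorm (x - xb)) => E g X X0 E0 EX.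
rewrite !ler_norml => /andP[h3 h4] /andP[h5 h6].
have h7 : C * E ^+ 2 <= C * rho * E.
  by rewrite expr2 mulrA; apply: ler_wpM2r => //; apply: ler_wpM2l => //; lra.
by apply/andP; split; lra.
Qed.

Lemma cvg_grad {S : Type} {F : set_system S} {FF : Filter F} h (u : S -> vec) x :
  C2_bound h xb rho C -> enorm (x - xb) < rho -> u @ F --> x ->
  (fun k => grad h (u k)) @ F --> grad h x.
Proof.
move=> hC xr /cvg_enormP ux; apply/cvg_enormP => e e0.
have [_ _ h3 _] := hC x xr.
have C1 : 0 < C + 1 by rewrite ltr_wpDl.
have h1 := ux _ (divr_gt0 e0 C1).
have h2 : \forall k \near F, enorm (u k - x) < rho - enorm (x - xb).
  by apply: ux; rewrite subr_gt0.
near=> k.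
have k1 : enorm (u k - x) < e / (C + 1) by near: k.
have k2 : enorm (u k - x) < rho - enorm (x - xb) by near: k.
rewrite ltr_pdivlMr// in k1; apply: le_lt_trans k1.
rewrite (le_trans (h3 _ _))//; last by have := enorm_ge0 (u k - x); lra.
by have := enorm_trans (u k) x xb; lra.
Unshelve. all: by end_near. Qed.

(** Complementarity kills two of the four products, and feasibility makes the two cross products
    nonpositive. *)
Lemma multiplier_cross y y' x x' i : multiplier s y -> multiplier s y' ->
  G x -> G x' -> y 0 i * phi i x = 0 -> y' 0 i * phi i x' = 0 ->
  0 <= (y' 0 i - y 0 i) * (phi i x' - phi i x).
Proof.
move=> ypos ypos' Gx Gx' yx yx'.
have h1 := multiplier_feasible i ypos Gx'.
have h2 := multiplier_feasible i ypos' Gx.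
by rewrite mulrBl !mulrBr yx yx'; lra.
Qed.

(** A violating sequence yields, in the limit, a direction [w] in the cone at [(x, y)] along which
    the second-order condition contradicts the violation. *)
Lemma local_monotonicity x v e : T x v -> enorm (x - xb) < rho ->
  enorm v < rho -> 0 < e -> exists2 d, 0 < d & forall x' v', T x' v' ->
    enorm (x' - x) < d -> enorm (v' - v) < d ->
    (sig - e) * enorm (x' - x) ^+ 2 <= dot (v' - v) (x' - x).
Proof.
move=> Tx xr vr e0; apply: contrapT => nex.
have Gx := rsubdiff_mem Tx.
(* Besides tending to zero, this radius keeps the pairs where bounded multipliers exist. *)
pose dk (k : nat) := Num.min (k.+1%:R^-1) (Num.min (rho - enorm (x - xb)) (rho - enorm v)).
have dk0 k : 0 < dk k by rewrite !lt_min invr_gt0 ltr0n !subr_gt0 xr vr.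
have /choice[q hq] : forall k, exists q : vec * vec * 'rV[R]_m,
    [/\ T q.1.1 q.1.2, enorm (q.1.1 - x) < dk k, enorm (q.1.2 - v) < dk k,
      dot (q.1.2 - v) (q.1.1 - x) < (sig - e) * enorm (q.1.1 - x) ^+ 2 &
      [/\ multiplier s q.2, forall i, q.2 0 i * phi i q.1.1 = 0,
        q.1.2 = gradL f phi q.1.1 q.2 & forall i, `|q.2 0 i| <= K]].
  move=> k; apply: contrapT => nq; apply: nex; exists (dk k) => // x' v' T' xd vd.
  rewrite leNgt; apply/negP => lt; apply: nq.
  have [||y hy] := multipliers T'.
  - move: xd; rewrite !lt_min => /and3P[_ ? _].
    by have := enorm_trans x' x xb; lra.
  - move: vd; rewrite !lt_min => /and3P[_ _ ?].
    by have := enormD (v' - v) v; rewrite subrK; lra.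
  by exists (x', v', y).
pose xk k := (q k).1.1; pose vk k := (q k).1.2; pose yk k := (q k).2.
(* The direction points from [xk k] back to [x]: for an inequality active at [x] the constraint
   value does not decrease that way, which is the sign required by [Scone]. *)
pose tk k := enorm (xk k - x); pose wk k := (tk k)^-1 *: (x - xk k).
have tk0 k : 0 < tk k.
  apply: enorm_gt0 => E; have [_ _ _ + _] := hq k.
  by rewrite -/(xk k) E dot0r enorm0 expr0n/= mulr0 ltxx.
have wk1 k : enorm (wk k) = 1.
  by rewrite /wk enormZ gtr0_norm ?invr_gt0// enormC mulVf// gt_eqF.
have xkw k : xk k - x = (- tk k) *: wk k.
  by rewrite /wk scaleNr scalerA divff ?gt_eqF// scale1r opprB.
(* One ultrafilter makes directions and multipliers converge simultaneously. *)
have [U [UU subU]] := ultraFilterLemma (eventually_filter).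
have [w wkw] : exists w : vec, wk @ U --> w.
  by apply: (@bounded_ultra R n _ U _ wk 1) => k; rewrite wk1.
have [y yky] : exists y : 'rV[R]_m, yk @ U --> y.
  apply: (@bounded_ultra R m _ U _ yk (m%:R * K)) => k.
  by apply: enorm_le_coords => // i; have [_ _ _ _ [_ _ _ +]] := hq k; apply.
have dkn (p : nat -> R) : (forall k, p k < dk k) -> forall e', 0 < e' ->
    \forall k \near U, p k < e'.
  move=> pd e' e'0; apply: subU; near=> k; apply: lt_trans (pd k) _.
  rewrite /dk gt_min; apply/orP; left.
  by near: k; exact: near_infty_natSinv_lt (PosNum e'0).
have xkx : xk @ U --> x.
  by apply/cvg_enormP; apply: dkn => k; have [] := hq k.
have vkv : vk @ U --> v.
  by apply/cvg_enormP; apply: dkn => k; have [] := hq k.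
have tk_0 : tk @ U --> (0 : R) by exact: cvg_enorm_dist.
have ykyi i : (fun k => yk k 0 i) @ U --> y 0 i.
  exact: (cvg_comp _ _ yky (@continuous_coord _ _ i y)).
have ykpos k : multiplier s (yk k) by have [_ _ _ _ []] := hq k.
have ykphi k i : yk k 0 i * phi i (xk k) = 0 by have [_ _ _ _ []] := hq k.
have ykK k i : `|yk k 0 i| <= K by have [_ _ _ _ []] := hq k.
have vkE k : vk k = gradL f phi (xk k) (yk k) by have [_ _ _ _ []] := hq k.
have Gxk k : G (xk k) by have [/rsubdiff_mem] := hq k.
have w1 : enorm w = 1.
  have h : (fun k => enorm (wk k)) @ U --> enorm w by exact: cvg_enorm.
  apply/eqP; rewrite eq_le; apply/andP; split.
    by apply: (@cvgr_to_le _ U _ R _ _ _ h); apply: filterE => k; rewrite wk1.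
  by apply: (@cvgr_to_ge _ U _ R _ _ _ h); apply: filterE => k; rewrite wk1.
have ypos : multiplier s y.
  move=> i is_; apply: (@cvgr_to_ge _ U _ R _ _ _ (ykyi i)).
  by apply: filterE => k; exact: ykpos.
have phixk i : (fun k => phi i (xk k)) @ U --> phi i x.
  exact: (cvg_comp _ _ xkx (C2_bound_continuous (phiC i) xr)).
have yphi i : y 0 i * phi i x = 0.
  have h : (fun k => yk k 0 i * phi i (xk k)) @ U --> y 0 i * phi i x by exact: cvgM.
  apply/eqP; rewrite eq_le; apply/andP; split.
    by apply: (@cvgr_to_le _ U _ R _ _ _ h); apply: filterE => k; rewrite ykphi.
  by apply: (@cvgr_to_ge _ U _ R _ _ _ h); apply: filterE => k; rewrite ykphi.
have vE : v = gradL f phi x y.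
  have h : vk @ U --> gradL f phi x y.
    rewrite (_ : vk = fun k => gradL f phi (xk k) (yk k)); last exact/funext.
    apply: cvgD; first exact: cvg_grad xkx.
    apply: cvg_big => [|i _]; first exact: add_continuous.
    by apply: cvgZ; [exact: ykyi|exact: cvg_grad (phiC i) xr xkx].
  exact: (cvg_unique _ vkv h).
have ygx0 : ygx phi y x = 0 by rewrite /ygx big1.
have dlim i : (fun k => dot (grad (phi i) x) (wk k)) @ U --> dot (grad (phi i) x) w.
  by apply: cvg_dot => //; exact: cvg_cst.
have Ctk : (fun k => C * tk k) @ U --> (0 : R).
  by rewrite -(mulr0 C); apply: cvgM => //; exact: cvg_cst.
have xkr : \forall k \near U, enorm (xk k - xb) < rho.
  have /cvg_enormP/(_ (rho - enorm (x - xb)))/[!subr_gt0]/(_ xr) h := xkx.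
  by apply: filterS h => k h; have := enorm_trans (xk k) x xb; lra.
have lin i : \forall k \near U,
    `|tk k * dot (grad (phi i) x) (wk k) - (phi i x - phi i (xk k))|
      <= tk k * (C * tk k).
  apply: filterS xkr => k kr; have [_ /(_ _ kr) + _ _] := phiC i xr.
  rewrite xkw dotZr -xkw -/(tk k) => h.
  rewrite mulrCA -expr2; apply: le_trans h.
  by rewrite le_eqVlt; apply/orP; left; apply/eqP; congr (`|_|); lra.
have dge i : phi i x = 0 -> (forall k, phi i (xk k) <= 0) ->
    0 <= dot (grad (phi i) x) w.
  move=> p0 pk; have h : (fun k => dot (grad (phi i) x) (wk k) + C * tk k) @ U -->
      dot (grad (phi i) x) w by rewrite -[X in _ --> X]addr0; exact: cvgD.
  apply: (@cvgr_to_ge _ U _ R _ _ _ h); apply: filterS (lin i) => k.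
  rewrite ler_norml p0 => /andP[h1 _]; have := pk k => h2.
  rewrite /= -(pmulr_rge0 _ (tk0 k)) mulrDr; lra.
have dle i : phi i x = 0 -> (\forall k \near U, phi i (xk k) = 0) ->
    dot (grad (phi i) x) w <= 0.
  move=> p0 pk; have h : (fun k => dot (grad (phi i) x) (wk k) - C * tk k) @ U -->
      dot (grad (phi i) x) w by rewrite -[X in _ --> X]subr0; exact: cvgB.
  apply: (@cvgr_to_le _ U _ R _ _ _ h); apply: filterS2 (lin i) pk => k.
  rewrite ler_norml p0 => /andP[_ h1] h2.
  rewrite /= -(pmulr_rle0 _ (tk0 k)) mulrBr; lra.
have cone : Scone s phi x y w.
  move=> i; have [Gi Ge] := Gx i; split.
    move=> [si|[[is_ p0] y0]]; apply/eqP; rewrite eq_le.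
      rewrite dle ?dge//; [exact: Ge|move=> k|exact: Ge|].
        by have [_ ->] := Gxk k i.
      by apply: filterE => k; have [_ ->] := Gxk k i.
    rewrite dle ?dge// => [k|]; first by have [->] := Gxk k i.
    (* A positive limit multiplier makes the nearby ones positive, so complementarity keeps the
       constraint active along the sequence. *)
    have h : \forall k \near U, 0 < yk k 0 i by exact: cvgr_gt (ykyi i) _ y0.
    apply: filterS h => k yk0.
    by have /eqP := ykphi k i; rewrite mulf_eq0 gt_eqF//= => /eqP.
  by move=> [[is_ p0] _]; apply: dge => // k; have [->] := Gxk k i.
have so := second_order xr vr ypos vE ygx0 cone.
rewrite (sec_order_ygx f w y phiC xr) w1 expr1n mulr1 in so.
have M0 : 0 < 2 * (1 + m%:R * K) by rewrite mulr_gt0// ltr_wpDr// mulr_ge0.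
(* Chosen so that the Hessian errors [e1 (1 + m K)] total [e / 2], half of the available gap. *)
pose e1 := e / (2 * (1 + m%:R * K)); have e10 : 0 < e1 by rewrite divr_gt0.
(* A lower bound for [<vk - v, xk - x> / tk^2]; its last terms pay for the Taylor remainders
   weighted by the change of multiplier, and vanish in the limit. *)
pose b k := quad (hess f x) (wk k) - e1 + \sum_(i < m)
  (yk k 0 i * quad (hess (phi i) x) (wk k) - K * e1 - `|yk k 0 i - y 0 i| * C).
have blim : b @ U --> quad (hess f x) w - e1 + \sum_(i < m)
    (y 0 i * quad (hess (phi i) x) w - K * e1 - `|y 0 i - y 0 i| * C).
  apply: cvgD; first by apply: cvgB; [exact: cvg_quad|exact: cvg_cst].
  apply: cvg_big => [|i _]; first exact: add_continuous.
  apply: cvgB; last first.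
    apply: cvgM; last exact: cvg_cst.
    by apply: cvg_norm; apply: cvgB => //; exact: cvg_cst.
  by apply: cvgB; [apply: cvgM => //; exact: cvg_quad|exact: cvg_cst].
have ble : \forall k \near U, b k <= sig - e.
  have [_ _ _ /(_ _ e10)[d d0 hd]] := fC xr.
  have [d' d'0 hd'] : exists2 d, 0 < d & forall z, enorm (z - x) < d -> forall i,
      `|dot (grad (phi i) z - grad (phi i) x) (z - x) -
        quad (hess (phi i) x) (z - x)| <= e1 * enorm (z - x) ^+ 2.
    by apply: forall_eball => i; have [_ _ _ /(_ _ e10)] := phiC i xr.
  have /cvg_enormP cx := xkx.
  have lin' : \forall k \near U, forall i,
      `|tk k * dot (grad (phi i) x) (wk k) - (phi i x - phi i (xk k))|
      <= tk k * (C * tk k) by exact: filter_forall.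
  apply: filterS3 (cx d d0) (cx d' d'0) lin' => k /hd hf /hd' hphi linp.
  have [_ _ _ + _] := hq k; rewrite -/(xk k) -/(vk k) -/(tk k) vkE vE => lt.
  rewrite -(ler_pM2l (exprn_gt0 2 (tk0 k))) [leRHS]mulrC; apply: le_trans (ltW lt).
  rewrite -/(tk k) in hf hphi.
  have -> : gradL f phi (xk k) (yk k) - gradL f phi x y =
     (grad f (xk k) - grad f x) + \sum_(i < m)
       (yk k 0 i *: (grad (phi i) (xk k) - grad (phi i) x) +
        (yk k 0 i - y 0 i) *: grad (phi i) x).
    rewrite /gradL opprD addrACA; congr (_ + _); rewrite -sumrB.
    by apply: eq_bigr => i _; rewrite scalerBr scalerBl addrA subrK.
  rewrite dotDl dot_suml /b mulrDr mulr_sumr; apply: lerD.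
    by move: hf; rewrite ler_norml {2}xkw quadZ sqrrN => /andP[]; lra.
  apply: ler_sum => i _; rewrite dotDl !dotZl.
  have h1 : `|yk k 0 i * (dot (grad (phi i) (xk k) - grad (phi i) x) (xk k - x)
      - quad (hess (phi i) x) (xk k - x))| <= K * (e1 * tk k ^+ 2).
    by rewrite normrM; apply: ler_pM (normr_ge0 _) (normr_ge0 _) (ykK k i) (hphi i).
  have h2 : `|(yk k 0 i - y 0 i) * (tk k * dot (grad (phi i) x) (wk k) -
      (phi i x - phi i (xk k)))| <= `|yk k 0 i - y 0 i| * (tk k * (C * tk k)).
    by rewrite normrM; apply: ler_wpM2l (normr_ge0 _) _ _ (linp i).
  (* Up to the Taylor remainder [h2], the contribution of the change of multiplier is this
     nonnegative product. *)
  have h3 := multiplier_cross ypos (ykpos k) Gx (Gxk k) (yphi i) (ykphi k i).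
  have h4 : dot (grad (phi i) x) (xk k - x) = - (tk k * dot (grad (phi i) x) (wk k)).
    by rewrite xkw dotZr mulNr.
  rewrite h4; move: h1 h2 h3; rewrite {2}xkw quadZ sqrrN.
  move: (dot _ (xk k - x)) (quad _ _) (dot _ (wk k)) (phi i x) (phi i (xk k)).
  move: (`|yk k 0 i - y 0 i|) (yk k 0 i) (y 0 i) (tk k) => z a a' t p r' l b1 b2.
  by rewrite !ler_norml => /andP[h1 _] /andP[_ h2] h3; lra.
(* The limit reads [sig - e / 2 <= sig - e], a contradiction. *)
have := @cvgr_to_le _ U _ R _ _ _ blim ble.
under eq_bigr do rewrite subrr normr0 mul0r subr0.
rewrite sumrB sumr_const card_ord -(mulr_natl (K * e1)).
have : e1 * (2 * (1 + m%:R * K)) = e by rewrite /e1 divfK// gt_eqF.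
by move=> e1E /(_ _)-lim; move: so e0 e1E lim; lra.
Unshelve. all: by end_near. Qed.

End SecondOrder.

(** * Closedness of the feasible set, choice of constants and assembly *)

Lemma feasible_ball_closed {R : realType} {n m : nat} (s : nat)
    (phi : 'I_m -> 'rV[R]_n -> R) (xb : 'rV[R]_n) (rho C g : R) :
  0 <= C -> (forall i, C2_bound (phi i) xb rho C) -> g < rho ->
  closed (feasible s phi `&` [set x | enorm (x - xb) <= g]).
Proof.
move=> C0 phiC gr; apply: closed_enormP => x hx.
have xg : enorm (x - xb) <= g.
  apply/ler_addgt0Pr => e /hx[y [_ /= yg] yx].
  by have := enorm_trans x y xb; rewrite (enormC x y); lra.
split=> // i; have phic := C2_bound_continuous C0 (phiC i) (le_lt_trans xg gr).
have near e : 0 < e -> exists2 y, feasible s phi y & `|phi i y - phi i x| < e.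
  move=> /((continuous_enormP _ _).1 phic)[d /hx[y [Gy _] yx] hd].
  by exists y => //; exact: hd.
split=> is_.
  apply/ler_addgt0Pr => e /near[y Gy]; have [/(_ is_) yi _] := Gy i.
  by rewrite ltr_norml => /andP[]; lra.
apply/eqP; rewrite -normr_eq0 eq_le normr_ge0 andbT.
apply/ler_addgt0Pr => e /near[y Gy]; have [_ /(_ is_) ->] := Gy i.
by rewrite sub0r normrN => h; rewrite add0r ltW.
Qed.

(** The interface between the two halves: local closedness, prox-regularity and pointwise
    monotonicity are all that is asked of the constrained problem. *)
Lemma variational_sufficiency {R : realType} {n : nat} (f : 'rV[R]_n -> R)
    (G : set 'rV[R]_n) (xb : 'rV[R]_n) (rho r sig : R) :
  let T := rsubdiff (constrained f G) in
  0 < rho -> 0 <= r -> 0 <= sig ->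
  (forall g, g < rho -> closed (G `&` [set x | enorm (x - xb) <= g])) ->
  (forall x, enorm (x - xb) < rho -> {for x, continuous f}) ->
  T xb 0 ->
  (forall x v u, T x v -> enorm (x - xb) < rho -> enorm v < rho ->
     G u -> enorm (u - xb) < rho ->
     f x + dot v (u - x) - r * enorm (u - x) ^+ 2 <= f u) ->
  (forall x v e, T x v -> enorm (x - xb) < rho -> enorm v < rho -> 0 < e ->
     exists2 d, 0 < d & forall x' v', T x' v' ->
       enorm (x' - x) < d -> enorm (v' - v) < d ->
       (sig - e) * enorm (x' - x) ^+ 2 <= dot (v' - v) (x' - x)) ->
  [/\ var_convex_mod sig (constrained f G) xb 0,
    local_min (constrained f G) xb &
    0 < sig -> tilt_stable sig^-1 (constrained f G) xb /\
      strong_local_min (constrained f G) xb].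
Proof.
move=> T rho0 r0 sig0 Gcl fc T0 prox mono; have Gxb := rsubdiff_mem T0.
(* [r + 1] gives [lam <= 1] together with [4 lam r <= 1], also when [r = 0]. *)
pose lam : R := (4 * (r + 1))^-1; pose g := rho / 2.
have r1 : 0 < 4 * (r + 1) by rewrite mulr_gt0// ltr_wpDl.
have lam0 : 0 < lam by rewrite invr_gt0.
have lamE : lam * (4 * (r + 1)) = 1 by rewrite mulVf// gt_eqF.
have lam1 : lam <= 1 by move: lamE; move: (lam) lam0 => l l0; nra.
have lamr : 4 * lam * r <= 1 by move: lamE; lra.
pose eta := Num.min g (lam * rho) / 10.
have g0 : 0 < g by rewrite divr_gt0.
have grho : g < rho by rewrite /g; lra.
have eta0 : 0 < eta by rewrite divr_gt0// lt_min g0 mulr_gt0.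
have etag : 10 * eta <= g by rewrite mulrC divfK// ge_min lexx.
have etal : 10 * eta <= lam * rho by rewrite mulrC divfK// ge_min lexx orbT.
have [a [a0 a1 arho growth]] := growth_near rho0 sig0 Gxb Gcl fc T0 prox mono
  lam0 lam1 lamr eta0 etag grho etal.
have resolvent z : enorm (z - xb) < eta -> exists2 p,
    T p (lam^-1 *: (z - p)) & enorm (p - xb) <= 4 * enorm (z - xb).
  move=> zb; have [p [? ? _ _]] := resolvent_exists rho0 Gxb Gcl fc T0 prox
    lam0 lamr eta0 etag grho etal zb.
  by exists p.
have lsub x v : enorm (x - xb) < a -> enorm v < a ->
    lsubdiff (constrained f G) x v -> T x v.
  move=> xa va; apply: (lsubdiff_constrained fc prox); exact: lt_le_trans arho.
have minl h v : 0 < h -> h < a -> exists p,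
    [/\ G p, enorm (p - xb) <= h & forall u, G u -> enorm (u - xb) <= h ->
    f p - dot v p <= f u - dot v u].
  move=> h0 ha; have [p [Gp ph pmin]] := min_on_ball Gxb Gcl fc (ltW h0)
    (lt_le_trans ha arho) (@continuous_dotB _ _ (- v) 0).
  exists p; split=> // u Gu uh; have := pmin u Gu uh.
  by rewrite !subr0 !dotNl.
split.
- exact: (var_convex_of_growth sig0 a0 a1 lam0 lam1 eta0 T0 growth resolvent lsub).
- exact: (local_min_of_growth sig0 a0 T0 growth).
- move=> s0; split; first exact: (tilt_stable_of_growth sig0 a0 T0 growth minl).
  exact: (strong_local_min_of_growth a0 T0 growth).
Qed.

Lemma C2_around_common {R : realType} {n m : nat} (f : 'rV[R]_n -> R)
    (phi : 'I_m -> 'rV[R]_n -> R) (xb : 'rV[R]_n) :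
  C2_around f xb -> (forall i, C2_around (phi i) xb) ->
  exists rho C, [/\ 0 < rho, 0 <= C, C2_bound f xb rho C &
    forall i, C2_bound (phi i) xb rho C].
Proof.
move=> /C2_around_bound[r [C [r0 C0 fC]]] phi2.
have /choice[q hq] : forall i, exists q : R * R,
    [/\ 0 < q.1, 0 <= q.2 & C2_bound (phi i) xb q.1 q.2].
  by move=> i; have [ri [Ci h]] := C2_around_bound (phi2 i); exists (ri, Ci).
have q2 i : 0 <= (q i).2 by have [] := hq i.
exists (\big[Num.min/r]_(i < m) (q i).1), (C + \sum_(i < m) (q i).2).
have S0 : 0 <= \sum_(i < m) (q i).2 by exact: sumr_ge0.
split.
- by apply: lt_bigmin => // i _; have [] := hq i.
- exact: addr_ge0.
- by apply: C2_bound_mono fC; [exact: bigmin_le_id|rewrite lerDl].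
- move=> i; have [_ _] := hq i; apply: C2_bound_mono; first exact: bigmin_le.
  rewrite ler_wpDl// (bigD1 i)//= lerDl; exact: sumr_ge0.
Qed.

Theorem theorem9p3 (R : realType) (n m s : nat) (hsm : (s <= m)%N)
  (f : 'rV[R]_n -> R) (phi : 'I_m -> 'rV[R]_n -> R)
  (xb : 'rV[R]_n) (yb : 'rV[R]_m) :
  C2_around f xb -> (forall i, C2_around (phi i) xb) ->
  feasible s phi xb ->
  multiplier s yb -> gradL f phi xb yb = 0 -> ygx phi yb xb = 0 ->
  MSCQ s phi xb ->
  (sec_order_cond s 0 f phi xb ->
     var_convex (PhiNLP s f phi) xb 0 /\ local_min (PhiNLP s f phi) xb) /\
  (forall sig : R, 0 < sig -> sec_order_cond s sig f phi xb ->
     var_convex_mod sig (PhiNLP s f phi) xb 0 /\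
     tilt_stable sig^-1 (PhiNLP s f phi) xb /\
     strong_local_min (PhiNLP s f phi) xb).
Proof.
move=> f2 phi2 Gxb ypos y0 yg [kap [r1 [kap0 [r10 mscq]]]].
have [r2 [C [r20 C0 fC phiC]]] := C2_around_common f2 phi2.
(* Both assertions are instances: [sig = 0] gives the first, [sig > 0] the second. *)
have main sig : 0 <= sig -> sec_order_cond s sig f phi xb ->
    [/\ var_convex_mod sig (PhiNLP s f phi) xb 0,
      local_min (PhiNLP s f phi) xb &
      0 < sig -> tilt_stable sig^-1 (PhiNLP s f phi) xb /\
        strong_local_min (PhiNLP s f phi) xb].
  move=> sig0 [rU [rV [rU0 [rV0 so]]]].
  (* A common radius for MSCQ, smoothness, and both neighbourhoods of the second-order condition. *)
  pose rho := Num.min (Num.min r1 r2) (Num.min rU rV).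
  have rho0 : 0 < rho by rewrite !lt_min r10 r20 rU0 rV0.
  have rho1 : rho <= r1 by rewrite !ge_min lexx.
  have rho2 : rho <= r2 by rewrite !ge_min lexx orbT.
  have rhoU : rho <= rU by rewrite !ge_min lexx !orbT.
  have rhoV : rho <= rV by rewrite !ge_min lexx !orbT.
  have {}fC : C2_bound f xb rho C by exact: C2_bound_mono fC.
  have {}phiC i : C2_bound (phi i) xb rho C by exact: C2_bound_mono (phiC i).
  have {}mscq x : enorm (x - xb) < rho -> Defs.dist x (feasible s phi) <=
      kap * \sum_(i < m) (if (i < s)%N then Num.max (phi i x) 0 else `|phi i x|).
    move=> xr; apply: (le_trans (mscq x (lt_le_trans xr rho1))).
    rewrite ler_wpM2l ?(ltW kap0)// big_mkcond/= [X in _ + X]big_mkcond/=.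
    rewrite -big_split; apply: ler_sum => i _ /=.
    by rewrite (leqNgt s i); case: ifP => _ /=; rewrite ?addr0 ?add0r.
  have T0 := stationary_rsubdiff rho0 fC phiC Gxb ypos y0 yg.
  have K0 := multiplier_bound_ge0 f xb rho0 C0 kap0.
  apply: (@variational_sufficiency R n f (feasible s phi) xb rho _ sig rho0 _ sig0).
  - exact: (addr_ge0 C0 (mulr_ge0 (ler0n _ m) (mulr_ge0 K0 C0))).
  - by move=> g gr; exact: (feasible_ball_closed C0 phiC gr).
  - by move=> x xr; exact: (C2_bound_continuous C0 fC xr).
  - exact: T0.
  - exact: (prox_regular rho0 C0 kap0 fC phiC mscq).
  - move=> x v e; apply: (local_monotonicity C0 K0 fC phiC).
      exact: (multiplier_bounded rho0 C0 kap0 fC phiC mscq).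
    move=> x' v' y xr vr.
    exact: (so _ _ _ (lt_le_trans xr rhoU) (lt_le_trans vr rhoV)).
split=> [/(main 0 (lexx _))[]//|sig sig0 /(main sig (ltW sig0))[vc _ /(_ sig0)[]]].
by [].
Qed.
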